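(* Let $\Omega:\mathbb{R}^n\setminus\{0\}\to\mathbb{R}$ be a measurable function with $\Omega(\lambda x)=\Omega(x)$ for all $\lambda>0$ and $x\in\mathbb{R}^n\setminus\{0\}$. Then $\Omega$ satisfies the $L^1$-Dini condition defined via rotations if and only if $\Omega$ satisfies the $L^1$-Dini condition defined via translations. That is, for such $\Omega$ with $\Omega\in L^1(\mathbb{S}^{n-1})$, $$\int_0^1\frac{\omega_1(\delta)}{\delta}\,d\delta<\infty\quad\Longleftrightarrow\quad\int_0^1\frac{\tilde\omega_1(\delta)}{\delta}\,d\delta<\infty.$$
   Context: $\mathbb{S}^{n-1}$ is the unit sphere of $\mathbb{R}^n$ and $\sigma$ is its surface (area) measure. Rotation version: $\Omega$ (homogeneous of degree zero) satisfies the $L^1$-Dini condition via rotations if $\Omega\in L^1(\mathbb{S}^{n-1})$ and $\int_0^1\frac{\omega_1(\delta)}{\delta}\,d\delta<\infty$, where $$\omega_1(\delta)=\sup_{\|\rho\|\le\delta}\int_{\mathbb{S}^{n-1}}|\Omega(\rho\theta)-\Omega(\theta)|\,d\sigma(\theta),$$ the supremum being over rotations $\rho$ of $\mathbb{R}^n$ with $\|\rho\|:=\sup\{|\rho x'-x'|:x'\in\mathbb{S}^{n-1}\}\le\delta$. Translation version: $\Omega$ (homogeneous of degree zero) satisfies the $L^1$-Dini condition via translations if $\Omega\in L^1(\mathbb{S}^{n-1})$ and $\int_0^1\frac{\tilde\omega_1(\delta)}{\delta}\,d\delta<\infty$, where $$\tilde\omega_1(\delta)=\sup_{h\in\mathbb{R}^n,\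 |h|\le\delta}\int_{\mathbb{S}^{n-1}}|\Omega(x'+h)-\Omega(x')|\,d\sigma(x').$$ *)

(* Defs.v *)
From HB Require Import structures.
From mathcomp Require Import all_boot all_order all_algebra.
From mathcomp Require Import all_classical all_reals all_analysis.
From mathcomp Require Import measurable_realfun.

Set Implicit Arguments.
Unset Strict Implicit.
Unset Printing Implicit Defensive.

Import Order.TTheory GRing.Theory Num.Theory.
Import numFieldNormedType.Exports.

Local Open Scope classical_set_scope.
Local Open Scope ring_scope.

(* R^n is the type 'cV[R]_n of column vectors, with the Borel sigma-algebra,
   generated by the coordinates. *)

Definition cV_display : measure_display.
Proof. exact: default_measure_display. Qed.

Section measurable_cV.
Context {R : realType} {n : nat}.

Definition cV_coord (i : 'I_n) (x : 'cV[R]_n) : measurableTypeR R := x i 0.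

Let cV_set0 : g_sigma_preimage cV_coord set0.
Proof. exact: sigma_algebra0. Qed.

Let cV_setC A : g_sigma_preimage cV_coord A -> g_sigma_preimage cV_coord (~` A).
Proof. exact: sigma_algebraC. Qed.

Let cV_bigcup (F : (set _)^nat) : (forall i, g_sigma_preimage cV_coord (F i)) ->
  g_sigma_preimage cV_coord (\bigcup_i (F i)).
Proof. exact: sigma_algebra_bigcup. Qed.

HB.instance Definition _ := @isMeasurable.Build cV_display 'cV[R]_n
  (g_sigma_preimage cV_coord) cV_set0 cV_setC cV_bigcup.

End measurable_cV.

Lemma measurable_cV_coord {R : realType} {n : nat} (i : 'I_n) :
  measurable_fun [set: 'cV[R]_n] (fun x => x i 0).
Proof.
move=> _ Y mY; rewrite setTI; apply: sub_sigma_algebra => /=.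
rewrite -bigcup_seq/=; exists i => /=; first by rewrite mem_index_enum.
by exists Y => //; rewrite setTI.
Qed.

Lemma measurable_fun_cVP {d} {T : measurableType d} {R : realType} {n : nat}
    (f : T -> 'cV[R]_n) :
  measurable_fun [set: T] f <->
  forall i, measurable_fun [set: T] (fun t => f t i 0).
Proof.
split=> [mf i|mf].
  exact: measurableT_comp (measurable_cV_coord i) mf.
suff prefS : g_sigma_preimage (fun i => cV_coord i \o f) `<=` measurable.
  move=> _ A mA; apply: prefS.
  by rewrite g_sigma_preimage_comp; exists A.
apply: smallest_sub; first exact: sigma_algebra_measurable.
move=> A; rewrite -bigcup_seq => -[i _ [B mB <-]].
exact: mf.
Qed.

Section lebesgue_measure_cV.
Local Open Scope ereal_scope.
Context {R : realType}.

Definition cons_cV n (p : measurableTypeR R * 'cV[R]_n) : 'cV[R]_n.+1 :=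
  col_mx (p.1%:M : 'cV[R]_1) p.2.

Lemma measurable_cons_cV n : measurable_fun setT (@cons_cV n).
Proof.
apply/measurable_fun_cVP => i.
have [j ij|j ij] := split_ordP (i : 'I_(1 + n)).
- rewrite (_ : (fun _ => _) = fst) //.
  by apply/funext => p; rewrite /cons_cV ij [LHS]col_mxEu ord1 mxE.
- rewrite (_ : (fun _ => _) = (fun x : 'cV[R]_n => x j 0%R) \o snd).
    by apply: measurableT_comp => //; exact: measurable_cV_coord.
  by apply/funext => p; rewrite /cons_cV ij [LHS]col_mxEd.
Qed.

(* Lebesgue measure on the Borel sets of R^n, as an iterated product. *)
Fixpoint lebesgue_cV n : set 'cV[R]_n -> \bar R :=
  match n return set 'cV[R]_n -> \bar R with
  | 0 => \d_ (0%R : 'cV[R]_0)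
  | n'.+1 => pushforward (lebesgue_measure \x @lebesgue_cV n') (@cons_cV n')
  end.

Section cons_measure.
Context {n : nat} (m : {sigma_finite_measure set 'cV[R]_n -> \bar R}).

Definition cons_measure : set 'cV[R]_n.+1 -> \bar R :=
  pushforward (lebesgue_measure \x m) (@cons_cV n).

HB.instance Definition _ := Measure.copy cons_measure
  (measure_function_pushforward__canonical__measure_function_Measure
    (lebesgue_measure \x m) (@measurable_cons_cV n)).

Let cons_measure_sigma_finite : sigma_finite setT cons_measure.
Proof.
have /sigma_finiteP[F [TF ndF Foo]] := sigma_finiteT (@lebesgue_measure R).
have /sigma_finiteP[G [TG ndG Goo]] := sigma_finiteT m.
pose hd (x : 'cV[R]_n.+1) : measurableTypeR R * 'cV[R]_n :=
  (x ord0 0%R, \col_i x (lift ord0 i) 0%R).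
have mhd : measurable_fun setT hd.
  apply: measurable_fun_pair; first exact: measurable_cV_coord.
  apply/measurable_fun_cVP => i.
  apply: (eq_measurable_fun (fun x : 'cV[R]_n.+1 => x (lift ord0 i) 0%R)).
    by move=> x _; rewrite mxE.
  exact: measurable_cV_coord.
have hdK : cancel (@cons_cV n) hd.
  move=> [t v]; rewrite /hd /cons_cV /=; congr pair.
    rewrite (_ : ord0 = lshift n ord0 :> 'I_(1 + n)) ?[LHS]col_mxEu ?mxE//.
    exact: val_inj.
  apply/colP => i; rewrite mxE.
  rewrite (_ : lift ord0 i = rshift 1 i :> 'I_(1 + n)) ?[LHS]col_mxEd //.
  exact: val_inj.
exists (fun k => hd @^-1` (F k `*` G k)).
  rewrite -preimage_bigcup (_ : \bigcup_k _ = setT) ?preimage_setT//.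
  rewrite -setXTT TF TG predeqE => -[x y]; split.
    by move=> [k _ []/= ? ?]; split; exists k.
  move=> [/= [j _ Fjx] [k _ Gky]]; exists (maxn j k) => //; split.
  - by move: x Fjx; exact/subsetPset/ndF/leq_maxl.
  - by move: y Gky; exact/subsetPset/ndG/leq_maxr.
move=> k; have [mF Fk] := Foo k; have [mG Gk] := Goo k; split.
  by rewrite -[X in measurable X]setTI; apply: mhd => //; exact: measurableX.
rewrite /cons_measure /pushforward -comp_preimage (_ : hd \o _ = id).
  by rewrite preimage_id product_measure1E// lte_mul_pinfty// ge0_fin_numE.
exact/funext.
Qed.

HB.instance Definition _ := Measure_isSigmaFinite.Build _ _ _ cons_measure
  cons_measure_sigma_finite.

End cons_measure.

Lemma lebesgue_cV_ex n :
  exists m : {sigma_finite_measure set 'cV[R]_n -> \bar R}, @lebesgue_cV n = m.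
Proof.
elim: n => [|n [m mE]].
  by exists [the {sigma_finite_measure set 'cV[R]_0 -> \bar R} of
    \d_ (0%R : 'cV[R]_0)].
by exists (cons_measure m); rewrite /= mE.
Qed.

Let lebesgue_cV0 n : @lebesgue_cV n set0 = 0.
Proof. by have [m ->] := lebesgue_cV_ex n; rewrite measure0. Qed.

Let lebesgue_cV_ge0 n A : 0 <= @lebesgue_cV n A.
Proof. by have [m ->] := lebesgue_cV_ex n; exact: measure_ge0. Qed.

Let lebesgue_cV_sigma_additive n : semi_sigma_additive (@lebesgue_cV n).
Proof.
by have [m ->] := lebesgue_cV_ex n; exact: measure_semi_sigma_additive.
Qed.

HB.instance Definition _ n := isMeasure.Build _ _ _ (@lebesgue_cV n)
  (lebesgue_cV0 n) (@lebesgue_cV_ge0 n) (@lebesgue_cV_sigma_additive n).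

Let lebesgue_cV_sigma_finite n : sigma_finite setT (@lebesgue_cV n).
Proof. by have [m ->] := lebesgue_cV_ex n; exact: sigma_finiteT. Qed.

HB.instance Definition _ n := Measure_isSigmaFinite.Build _ _ _
  (@lebesgue_cV n) (lebesgue_cV_sigma_finite n).

End lebesgue_measure_cV.
Arguments lebesgue_cV : clear implicits.

Section sphere.
Context {R : realType} {n : nat}.
Implicit Types x : 'cV[R]_n.

(* The library's norm on matrices is the sup norm. *)
Definition enorm x : R := Num.sqrt (\sum_(i < n) x i 0 ^+ 2).

Definition sphere : set 'cV[R]_n := [set x | enorm x = 1].

Definition radial x : 'cV[R]_n := (enorm x)^-1 *: x.

Lemma measurable_enorm : measurable_fun [set: 'cV[R]_n] enorm.
Proof.
apply: (measurableT_comp (continuous_measurable_fun (@sqrt_continuous R))).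
apply: measurable_sum => i; apply: measurable_funX.
exact: measurable_cV_coord.
Qed.

Lemma measurable_radial : measurable_fun [set: 'cV[R]_n] radial.
Proof.
apply/measurable_fun_cVP => i.
rewrite (_ : (fun _ => _) = fun x => powR (enorm x) (-1) * x i 0); last first.
  by apply/funext => x; rewrite mxE powR_inv1// sqrtr_ge0.
apply: measurable_funM; last exact: measurable_cV_coord.
exact: (measurableT_comp (measurable_powR (-1)) measurable_enorm).
Qed.

Definition punctured_ball : set 'cV[R]_n := [set x | 0 < enorm x <= 1].

Lemma measurable_punctured_ball : measurable punctured_ball.
Proof.
rewrite (_ : punctured_ball = setT `&` enorm @^-1` `]0, 1]).
  by apply: measurable_enorm.
by apply/seteqP; split => x; rewrite /punctured_ball /= in_itv /= => // -[].
Qed.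

Local Open Scope ereal_scope.

(* The surface measure of S^{n-1} on Borel sets, given by polar coordinates as
   A |-> n * |{r x' : 0 < r <= 1, x' \in A}|, and extended by 0 off the sphere. *)
Definition surface_measure (A : set 'cV[R]_n) : \bar R :=
  n%:R%:E * lebesgue_cV R n (radial @^-1` A `&` punctured_ball).

HB.instance Definition _ := Measure.copy surface_measure
  (measure_function_pushforward__canonical__measure_function_Measure
    (mscale (n%:R%:nng : {nonneg R})%R (mrestr (lebesgue_cV R n) measurable_punctured_ball))
    measurable_radial).

End sphere.
Arguments sphere : clear implicits.
Arguments surface_measure : clear implicits.

(* Measurable and integrable are meant in the sense of Lebesgue: the Borel
   measures above are completed. *)
Definition lebesgue_type (R : realType) (n : nat) : measurableType _ :=
  caratheodory_type (mu_ext (lebesgue_cV R n)).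

Definition surface_type (R : realType) (n : nat) : measurableType _ :=
  caratheodory_type (mu_ext (surface_measure R n)).

Definition sigma (R : realType) (n : nat) : set (surface_type R n) -> \bar R :=
  completed_measure_extension (mu := surface_measure R n).

HB.instance Definition _ R n := Measure.on (@sigma R n).
Arguments sigma : clear implicits.

Section dini.
Context {R : realType} {n : nat}.
Implicit Types (rho : 'M[R]_n) (Omega : 'cV[R]_n -> R) (delta : R).

Definition rotation rho : Prop := rho *m rho^T = 1%:M /\ \det rho = 1.

Definition rotation_norm rho : R :=
  sup [set enorm (rho *m x - x) | x in sphere R n].

Local Open Scope ereal_scope.

Definition omega_rot Omega delta : \bar R :=
  ereal_sup [set \int[sigma R n]_(x in sphere R n)
                   `|Omega (rho *m x) - Omega x|%:E
            | rho in [set rho | rotation rho /\ (rotation_norm rho <= delta)%R]].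

(* Omega is only meant on R^n \ {0}; x + h = 0 occurs for at most one x on the
   sphere, and only when |h| = 1, so the value Omega 0 has no influence on the
   Dini integral. *)
Definition omega_trans Omega delta : \bar R :=
  ereal_sup [set \int[sigma R n]_(x in sphere R n) `|Omega (x + h)%R - Omega x|%:E
            | h in [set h | (enorm h <= delta)%R]].

Definition dini (omega : R -> \bar R) : Prop :=
  \int[lebesgue_measure]_(delta in `]0%R, 1%R[) (omega delta * delta^-1%:E) < +oo.

Definition L1_sphere Omega : Prop :=
  (sigma R n).-integrable (sphere R n) (EFin \o Omega).

Definition L1_dini_rotations Omega : Prop :=
  L1_sphere Omega /\ dini (omega_rot Omega).

Definition L1_dini_translations Omega : Prop :=
  L1_sphere Omega /\ dini (omega_trans Omega).

End dini.

(* Main.v *)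
(* Let g be a Borel, 0-homogeneous function that agrees with Omega off a null
   set. Both moduli of continuity are compared with the average
     D(d) = int_{|x| <= 1} int_{|h| <= d} |g(x + |x|h) - g(x)| dh dx.

   If T preserves the norm, moves x by at most d|x| and satisfies
   |x - y| <= c |T x - T y|, then inserting g(x + |x|h) and averaging over
   |h| <= d gives int |g(T x) - g(x)| dx <= C d^-n D(2d): the second term is an
   instance of D, because x + |x|h = T x + |T x|k with k = h + (x - T x)/|x|.
   This applies to rotations and to x |-> |x| (x + |x|h)/|x + |x|h|, so both
   moduli at d are bounded by a multiple of d^-n D(Cd).

   Conversely D(d) <= C d^n omega_trans(d) by Tonelli. To bound D(d) by
   d^n omega_rot(16d), insert an integration over auxiliary vectors w. If u and
   v point nearly opposite to w, then g(u) = g(R_a w) and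
   g(v) = g(R_b w), where R_a is the reflection with normal
   a = u - |u| w/|w|, and R_b likewise for v. Integrating in w first, z = R_b w
   turns |g(R_a w) - g(R_b w)| into |g(R_a R_b z) - g(z)|, where R_a R_b is a
   rotation close to the identity.

   All changes of variables are expanding maps, and only bounds up to a constant
   are needed, so they all follow from one inequality: if
   |x - y| <= c |G x - G y| on K, then lambda(G^-1(A) `&` K) <= C lambda(A). It
   is clear for cubes, and extends to Borel sets by the monotone class theorem. *)

Require Import Defs.
From HB Require Import structures.
From mathcomp Require Import all_boot all_order all_algebra.
From mathcomp Require Import all_classical all_reals all_analysis.
From mathcomp Require Import measurable_realfun ring lra.

Set Implicit Arguments.
Unset Strict Implicit.
Unset Printing Implicit Defensive.

Import Order.TTheory GRing.Theory Num.Theory.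
Import numFieldNormedType.Exports.

Local Open Scope classical_set_scope.
Local Open Scope ring_scope.

(** * Domination of measures on a filtration by cells *)

Section cells.
Local Open Scope ereal_scope.
Context d (T : measurableType d) (R : realType).
Variables (mu nu : {measure set T -> \bar R}) (q : nat -> T -> nat).
Hypotheses (mq : forall k i, measurable (q k @^-1` [set i]))
  (qS : forall k x y, q k.+1 x = q k.+1 y -> q k x = q k y)
  (qgen : measurable `<=` <<s [set A | exists k i, A = q k @^-1` [set i]] >>)
  (mu_fin : forall i, mu (q 0 @^-1` [set i]) < +oo)
  (le_numu : forall k i, nu (q k @^-1` [set i]) <= mu (q k @^-1` [set i])).

Definition saturated k (A : set T) := forall x y, q k x = q k y -> A x -> A y.

Lemma saturatedE k A : saturated k A ->
  A = \bigcup_(i in q k @` A) (q k @^-1` [set i]).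
Proof.
move=> sA; apply/seteqP; split => [x Ax|x [_ [y Ay <-]] /= qxy].
  by exists (q k x) => //; exists x.
exact: sA Ay.
Qed.

Lemma trivIset_cells k D : trivIset D (fun i => q k @^-1` [set i]).
Proof. by move=> i j _ _ [x [/= -> ->]]. Qed.

Lemma measurable_saturated k A : saturated k A -> measurable A.
Proof.
by move=> /saturatedE ->; apply: bigcup_measurable => i _; exact: mq.
Qed.

Lemma saturated_le k A : saturated k A -> nu A <= mu A.
Proof.
move=> /saturatedE ->; rewrite !measure_bigcup//; try exact: trivIset_cells.
by apply: lee_nneseries => i _ //; exact: measure_ge0.
Qed.

Lemma saturatedS k A : saturated k A -> saturated k.+1 A.
Proof. by move=> sA x y /qS; exact: sA. Qed.

Lemma saturated_homo k m A : (k <= m)%N -> saturated k A -> saturated m A.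
Proof.
move=> km sA; rewrite -(subnK km).
by elim: (m - k)%N => // j ih; rewrite addSn; exact: saturatedS.
Qed.

(** The inequality holds on saturated sets by countable additivity and survives monotone limits, so
    the monotone class theorem applies to the ring of saturated sets. Limits of decreasing sequences
    require finite measure, which is why everything is first intersected with one cell of level
    0. *)
Lemma le_measure_cells A : measurable A -> nu A <= mu A.
Proof.
pose Q i := q 0 @^-1` [set i].
suff leQ i B : measurable B -> nu (B `&` Q i) <= mu (B `&` Q i).
  move=> mA; have AE : A = \bigcup_(j in setT) (A `&` Q j).
    by rewrite -setI_bigcupr; apply/esym/setIidPl => x _; exists (q 0 x).
  have mAQ j : setT j -> measurable (A `&` Q j).
    by move=> _; apply: measurableI => //; exact: mq.
  have tAQ : trivIset setT (fun j => A `&` Q j).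
    by apply: trivIset_setIl; apply: (@trivIset_cells 0).
  rewrite AE !measure_bigcup//.
  by apply: lee_nneseries => *; [exact: measure_ge0|exact: leQ].
pose M := [set B | measurable B /\ nu (B `&` Q i) <= mu (B `&` Q i)].
pose G := [set B | exists k, saturated k B].
have GM : G `<=` M.
  move=> C [k sC]; split; first exact: measurable_saturated sC.
  apply: (@saturated_le k) => x y qxy [Cx Qx]; split; first exact: sC Cx.
  rewrite /Q /= -Qx; apply/esym.
  (* Equality of cells passes from level [k] down to level 0. *)
  by elim: (k) qxy => // m ih /qS.
have rG : setring G.
  split; first by exists 0%N => ? ?.
    move=> C D [k sC] [m sD]; exists (maxn k m).
    move: sC => /(saturated_homo (leq_maxl k m)) sC.
    move: sD => /(saturated_homo (leq_maxr k m)) sD.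
    by move=> x y qxy [Cx|Dx]; [left; exact: sC Cx|right; exact: sD Dx].
  move=> C D [k sC] [m sD]; exists (maxn k m).
  move: sC => /(saturated_homo (leq_maxl k m)) sC.
  move: sD => /(saturated_homo (leq_maxr k m)) sD.
  move=> x y qxy [Cx Dx]; split; first exact: sC Cx.
  by move=> Dy; apply: Dx; exact: sD Dy.
have fin_nu : nu (Q i) < +oo by exact: le_lt_trans (le_numu _ _) (mu_fin _).
have mono : monotone M.
  have mQ : measurable (Q i) by exact: mq.
  split => F mF MF.
    have mFi j : measurable (F j `&` Q i).
      by apply: measurableI => //; have [] := MF j.
    have ndF : nondecreasing_seq (fun j => F j `&` Q i).
      by move=> a b ab; apply/subsetPset; apply: setSI; exact/subsetPset/mF.
    split; first by apply: bigcup_measurable => j _; have [] := MF j.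
    have mU : measurable (\bigcup_j (F j `&` Q i)) by exact: bigcup_measurable.
    have c1 := nondecreasing_cvg_mu (mu := mu) mFi mU ndF.
    have c2 := nondecreasing_cvg_mu (mu := nu) mFi mU ndF.
    rewrite setI_bigcupl -(cvg_lim _ c1)// -(cvg_lim _ c2)//.
    apply: lee_lim; [by apply/cvg_ex; eexists; exact: c2
      |by apply/cvg_ex; eexists; exact: c1|].
    by apply: nearW => j; have [] := MF j.
  have mFi j : measurable (F j `&` Q i).
    by apply: measurableI => //; have [] := MF j.
  have niF : nonincreasing_seq (fun j => F j `&` Q i).
    by move=> a b ab; apply/subsetPset; apply: setSI; exact/subsetPset/mF.
  split; first by apply: bigcap_measurable => // j _; have [] := MF j.
  have mU : measurable (\bigcap_j (F j `&` Q i)).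
    by apply: bigcap_measurable.
  have f1 : mu (F 0%N `&` Q i) < +oo.
    apply: le_lt_trans (mu_fin i); apply: le_measure; rewrite ?inE//.
  have f2 : nu (F 0%N `&` Q i) < +oo.
    apply: le_lt_trans fin_nu; apply: le_measure; rewrite ?inE//.
  have c1 := nonincreasing_cvg_mu (mu := mu) f1 mFi mU niF.
  have c2 := nonincreasing_cvg_mu (mu := nu) f2 mFi mU niF.
  rewrite -bigcapIl//.
  rewrite -(cvg_lim _ c1)// -(cvg_lim _ c2)//.
  apply: lee_lim; [by apply/cvg_ex; eexists; exact: c2
    |by apply/cvg_ex; eexists; exact: c1|].
  by apply: nearW => j; have [] := MF j.
have := monotone_setring_sub_g_sigma_ring mono rG GM.
move=> srM mB; apply: (srM B _).2.
move/qgen : mB; apply: smallest_sub; last first.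
  move=> C [k [j ->]]; apply: sub_g_sigma_ring; exists k.
  by move=> x y /= ->.
(* The whole space is saturated, so this sigma-ring is closed under complements. *)
have [s0 sD sU] := smallest_sigma_ring G.
split => // C GC; apply: sD => //.
by apply: sub_g_sigma_ring; exists 0%N.
Qed.

End cells.

(** * Euclidean geometry *)

Section euclid.
Context {R : realType} {n : nat}.
Implicit Types (x y z : 'cV[R]_n) (a b r s : R).

Definition dotp x y : R := \sum_(i < n) x i 0 * y i 0.

Lemma dotpC x y : dotp x y = dotp y x.
Proof. by apply: eq_bigr => i _; rewrite mulrC. Qed.

Lemma dotpDl x y z : dotp (x + y) z = dotp x z + dotp y z.
Proof. by rewrite -big_split; apply: eq_bigr => i _; rewrite mxE mulrDl. Qed.

Lemma dotpZl a x z : dotp (a *: x) z = a * dotp x z.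
Proof. by rewrite mulr_sumr; apply: eq_bigr => i _; rewrite mxE mulrA. Qed.

Lemma dotpDr x y z : dotp x (y + z) = dotp x y + dotp x z.
Proof. by rewrite dotpC dotpDl !(dotpC x). Qed.

Lemma dotpZr a x z : dotp x (a *: z) = a * dotp x z.
Proof. by rewrite dotpC dotpZl dotpC. Qed.

Lemma dotpNl x z : dotp (- x) z = - dotp x z.
Proof. by rewrite -scaleN1r dotpZl mulN1r. Qed.

Lemma dotpNr x z : dotp x (- z) = - dotp x z.
Proof. by rewrite dotpC dotpNl dotpC. Qed.

Definition dotpE := (dotpDl, dotpDr, dotpZl, dotpZr, dotpNl, dotpNr).

Lemma dotp_ge0 x : 0 <= dotp x x.
Proof. by apply: sumr_ge0 => i _; rewrite -expr2 sqr_ge0. Qed.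

Lemma enorm_sqr x : enorm x ^+ 2 = dotp x x.
Proof. by rewrite sqr_sqrtr//; apply: sumr_ge0 => i _; exact: sqr_ge0. Qed.

Lemma enorm_ge0 x : 0 <= enorm x. Proof. exact: sqrtr_ge0. Qed.

Lemma enorm0 : enorm (0 : 'cV[R]_n) = 0.
Proof. by rewrite /enorm big1 ?sqrtr0// => i _; rewrite mxE expr0n. Qed.

Lemma enorm_eq0 x : (enorm x == 0) = (x == 0).
Proof.
apply/eqP/eqP => [x0|->]; last exact: enorm0.
apply/colP => i; rewrite mxE; apply/eqP; rewrite -sqrf_eq0.
have /eqP : dotp x x = 0 by rewrite -enorm_sqr x0 expr0n.
rewrite psumr_eq0; last by move=> j _; rewrite -expr2 sqr_ge0.
by move=> /allP/(_ i); rewrite mem_index_enum expr2 => /(_ isT).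
Qed.

Lemma enorm_gt0 x : (0 < enorm x) = (x != 0).
Proof. by rewrite lt0r enorm_ge0 andbT enorm_eq0. Qed.

Lemma eq_enorm x y : dotp x x = dotp y y -> enorm x = enorm y.
Proof.
move=> xy; apply/eqP; rewrite -(@eqrXn2 _ 2)// ?enorm_ge0//.
by rewrite !enorm_sqr xy.
Qed.

Lemma enormZ a x : enorm (a *: x) = `|a| * enorm x.
Proof.
apply/eqP; rewrite -(@eqrXn2 _ 2)// ?mulr_ge0 ?enorm_ge0//.
by rewrite exprMn !enorm_sqr !dotpE real_normK ?num_real// mulrA.
Qed.

Lemma enormN x : enorm (- x) = enorm x.
Proof. by rewrite -scaleN1r enormZ normrN1 mul1r. Qed.

Lemma enormBC x y : enorm (x - y) = enorm (y - x).
Proof. by rewrite -enormN opprB. Qed.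

(** Cauchy-Schwarz, by expanding the squared norm of [enorm y *: x - enorm x *: y]. *)
Lemma dotp_le x y : dotp x y <= enorm x * enorm y.
Proof.
have [->|x0] := eqVneq x 0.
  by rewrite enorm0 mul0r -(scale0r 0) dotpZl mul0r.
have [->|y0] := eqVneq y 0.
  by rewrite enorm0 mulr0 -(scale0r 0) dotpZr mul0r.
have := dotp_ge0 (enorm y *: x - enorm x *: y).
rewrite !dotpE (dotpC y x) -!enorm_sqr.
have : 0 < enorm x * enorm y by rewrite mulr_gt0 ?enorm_gt0.
move: (enorm x) (enorm y) (dotp x y) => p q d pq H.
rewrite -(ler_pM2l pq); lra.
Qed.

Lemma enormD x y : enorm (x + y) <= enorm x + enorm y.
Proof.
rewrite -ler_sqr ?nnegrE ?addr_ge0 ?enorm_ge0//.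
rewrite sqrrD !enorm_sqr !dotpE (dotpC y x) -!enorm_sqr.
have := dotp_le x y; lra.
Qed.

Lemma enormB x y : enorm (x - y) <= enorm x + enorm y.
Proof. by rewrite (le_trans (enormD _ _))// enormN. Qed.

Lemma enorm_subD z x y : enorm (x - y) <= enorm (x - z) + enorm (z - y).
Proof. by rewrite (le_trans _ (enormD _ _))// addrA subrK. Qed.

Lemma enorm_sub_ge x y : enorm x - enorm y <= enorm (x - y).
Proof. by have := enormD (x - y) y; rewrite subrK; lra. Qed.

Lemma dist_enorm x y : `|enorm x - enorm y| <= enorm (x - y).
Proof.
by rewrite ler_norml enorm_sub_ge andbT; have := enorm_sub_ge y x;
  rewrite enormBC; lra.
Qed.

Lemma coord_le_enorm x i : `|x i 0| <= enorm x.
Proof.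
rewrite -ler_sqr ?nnegrE ?enorm_ge0// real_normK ?num_real// enorm_sqr.
rewrite /dotp (bigD1 i)//= -expr2 lerDl.
by apply: sumr_ge0 => j _; rewrite -expr2 sqr_ge0.
Qed.

(** The crude factor [n], in place of its square root, keeps the constants polynomial in [n%:R]. *)
Lemma enorm_le_coord x s : (forall i, `|x i 0| <= s) -> enorm x <= n%:R * s.
Proof.
move=> xs; have [n0|n0] := posnP n.
  rewrite /enorm big1 ?sqrtr0 ?n0 ?mul0r// => i _.
  by exfalso; move: (ltn_ord i); rewrite {2}n0.
have s0 : 0 <= s by rewrite (le_trans _ (xs (Ordinal n0))).
rewrite -ler_sqr ?nnegrE ?enorm_ge0 ?mulr_ge0// enorm_sqr.
apply: (@le_trans _ _ (\sum_(i < n) s ^+ 2)).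
  apply: ler_sum => i _; rewrite -expr2 -(@real_normK _ (x i 0)) ?num_real//.
  by apply: lerXn2r; rewrite ?nnegrE.
rewrite sumr_const card_ord -(mulr_natl (s ^+ 2)) exprMn.
apply: ler_wpM2r; first exact: sqr_ge0.
by rewrite expr2 -natrM ler_nat leq_pmulr.
Qed.

Lemma radialZ a x : 0 < a -> radial (a *: x) = radial x.
Proof.
move=> a0; rewrite /radial enormZ gtr0_norm// scalerA invfM mulrAC.
by rewrite mulVf ?mul1r ?gt_eqF.
Qed.

Lemma enorm_radial x : x != 0 -> enorm (radial x) = 1.
Proof.
move=> x0; rewrite /radial enormZ normfV ger0_norm ?enorm_ge0//.
by rewrite mulVf// enorm_eq0.
Qed.

Lemma radial_sphere x : sphere R n x -> radial x = x.
Proof. by rewrite /sphere/= /radial => ->; rewrite invr1 scale1r. Qed.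

Lemma enorm_radialK x : enorm x *: radial x = x.
Proof.
have [->|x0] := eqVneq x 0; first by rewrite enorm0 scale0r.
by rewrite scalerA divff ?scale1r ?enorm_eq0.
Qed.

Lemma sphere_neq0 x : sphere R n x -> x != 0.
Proof. by rewrite -enorm_gt0 /sphere /= => ->. Qed.

Lemma measurable_sphere : measurable (sphere R n).
Proof.
rewrite (_ : sphere R n = setT `&` enorm @^-1` [set 1]); last by rewrite setTI.
exact: measurable_enorm.
Qed.

Definition enball r : set 'cV[R]_n := [set x | enorm x <= r].

Lemma measurable_enball r : measurable (enball r).
Proof.
rewrite (_ : enball r = setT `&` enorm @^-1` `]-oo, r]); last first.
  by rewrite setTI; apply/seteqP; split => x /=; rewrite in_itv.
exact: measurable_enorm.
Qed.

End euclid.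
Arguments enball : clear implicits.

(** * Cubes and dyadic cells *)

Section cubes.
Context {R : realType}.
Implicit Types s : R.

(** Half-open, so that the dyadic cubes of a given side partition the space. *)
Definition cube n (a : 'cV[R]_n) s : set 'cV[R]_n :=
  [set x | forall i, a i 0 <= x i 0 < a i 0 + s].

Lemma measurable_cube n (a : 'cV[R]_n) s : measurable (cube a s).
Proof.
rewrite (_ : cube a s = \bigcap_(i in [set: 'I_n])
    ([set: 'cV[R]_n] `&` (fun x => x i 0) @^-1` `[a i 0, a i 0 + s[)).
  apply: fin_bigcap_measurable => // i _; apply: measurable_cV_coord => //.
apply/seteqP; split => [x cx i _|x cx i]; first by rewrite /= in_itv/=; split.
by have /= [_] := cx i I; rewrite in_itv.
Qed.

Lemma cons_cV0 n (p : measurableTypeR R * 'cV[R]_n) : cons_cV p ord0 0 = p.1.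
Proof.
rewrite /cons_cV (_ : ord0 = lshift n ord0 :> 'I_(1 + n)); last exact: val_inj.
by rewrite [LHS]col_mxEu mxE.
Qed.

Lemma cons_cVS n (p : measurableTypeR R * 'cV[R]_n) i :
  cons_cV p (lift ord0 i) 0 = p.2 i 0.
Proof.
rewrite /cons_cV (_ : lift ord0 i = rshift 1 i :> 'I_(1 + n)).
  by rewrite [LHS]col_mxEd.
exact: val_inj.
Qed.

Lemma lebesgue_cube n (a : 'cV[R]_n) s : 0 <= s ->
  lebesgue_cV R n (cube a s) = (s ^+ n)%:E.
Proof.
move=> s0; elim: n a => [|n ih] a.
  by rewrite /= diracE mem_set ?expr0// => -[].
rewrite /= /pushforward.
rewrite (_ : @cons_cV R n @^-1` _ =
    `[a ord0 0, a ord0 0 + s[ `*` cube (\col_i a (lift ord0 i) 0) s);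
    last first.
  apply/seteqP; split => [[t v]/= cx|[t v]/= [+ cv] i].
    split => [|i]; first by have := cx ord0; rewrite cons_cV0 in_itv.
    by have := cx (lift ord0 i); rewrite cons_cVS mxE.
  rewrite in_itv/= => tE; have [j ->|->] := unliftP ord0 i.
    by rewrite cons_cVS; have := cv j; rewrite mxE.
  by rewrite cons_cV0.
rewrite product_measure1E//=; last exact: measurable_cube.
rewrite lebesgue_measure_itv/= lte_fin; case: ltP => as_; last first.
  have -> : s = 0 by move: as_ s0; lra.
  by rewrite mul0e expr0n.
by rewrite ih exprS EFinM; congr (_ * _)%E; rewrite -EFinB addrAC subrr add0r.
Qed.

End cubes.

Section dyadic.
Context {R : realType} {n : nat}.
Implicit Types x y : 'cV[R]_n.

(** The integer vector of floors is coded by [pickle], because [le_measure_cells] indexes cells by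
    natural numbers. *)
Definition dyadic k x : nat :=
  pickle (\col_i Num.floor (2 ^+ k * x i 0) : 'cV[int]_n).

Lemma dyadicP k x y :
  dyadic k x = dyadic k y <->
  forall i, Num.floor (2 ^+ k * x i 0) = Num.floor (2 ^+ k * y i 0).
Proof.
split=> [/(pcan_inj pickleK)/colP xy i|xy]; first by have := xy i; rewrite !mxE.
by congr pickle; apply/colP => i; rewrite !mxE.
Qed.

Lemma dyadic_cell k x : dyadic k @^-1` [set dyadic k x] =
  cube (\col_i ((Num.floor (2 ^+ k * x i 0))%:~R / 2 ^+ k)) (2 ^+ k)^-1.
Proof.
have p0 : 0 < 2 ^+ k :> R by rewrite exprn_gt0.
have E (z : R) (m : int) :
    (m%:~R / 2 ^+ k <= z < m%:~R / 2 ^+ k + (2 ^+ k)^-1) =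
    (m%:~R <= 2 ^+ k * z < (m + 1)%:~R).
  rewrite intrD -[X in _ + X]mul1r -mulrDl ler_pdivrMr// ltr_pdivlMr//.
  by rewrite (mulrC z).
apply/seteqP; split => y /=.
  by move=> /dyadicP xy i; rewrite mxE E -xy floor_itv.
move=> cy; apply/dyadicP => i; have := cy i; rewrite mxE E.
by move/floor_def.
Qed.

(** Not every natural number codes an integer vector, so some indices carry no cube. *)
Lemma dyadic_cell_empty k i : dyadic k @^-1` [set i] = set0 \/
  exists x, dyadic k x = i.
Proof.
have [[x xi]|] := pselect (exists x, dyadic k x = i); first by right; exists x.
by move=> /forallNP xi; left; apply/seteqP; split => // x /xi.
Qed.

Lemma measurable_dyadic_cell k i : measurable (dyadic k @^-1` [set i]).
Proof.
have [->//|[x <-]] := dyadic_cell_empty k i.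
by rewrite dyadic_cell; exact: measurable_cube.
Qed.

Lemma dyadicS k x y : dyadic k.+1 x = dyadic k.+1 y -> dyadic k x = dyadic k y.
Proof.
(* The floor of [u] is the largest integer m with 2m at most the floor of [2 * u], hence is
   determined by the latter. *)
have le2 (u v : R) : Num.floor (2 * u) = Num.floor (2 * v) ->
    (Num.floor u <= Num.floor v)%O.
  move=> uv; rewrite floor_ge_int -(ler_pM2l (ltr0n R 2 : 0 < 2)) -[2]/(2%:~R).
  by rewrite -intrM -floor_ge_int -uv floor_ge_int intrM ler_pM2l// floor_le.
move=> /dyadicP xy; apply/dyadicP => i; have := xy i; rewrite exprS -!mulrA.
by move=> e; apply/eqP; rewrite eq_le !le2.
Qed.

(** The lower corners of the cells containing x converge to x from below as the side shrinks. Hence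
    the half-space of points whose coordinate [i] exceeds r is the countable union of the cells
    whose lower corner already satisfies this. *)
Lemma dyadic_generates : (measurable : set (set 'cV[R]_n)) `<=`
  <<s [set A | exists k i, A = dyadic k @^-1` [set i]] >>.
Proof.
set G := [set A | _]; apply: smallest_sub; first exact: smallest_sigma_algebra.
move=> A; rewrite -bigcup_seq => -[i _ [B mB <-]].
have : measurable_fun setT
    (fun x : g_sigma_algebraType G => x i 0 : measurableTypeR R).
  apply: (measurability _ (RGenOInfty.measurableE R)) => //.
  move=> _ [_ [r ->] <-]; rewrite setTI.
  have -> : (fun x : g_sigma_algebraType G => x i 0 : R) @^-1` `]r, +oo[ =
      \bigcup_k \bigcup_(j in dyadic k @`
        [set x : 'cV[R]_n | r < (Num.floor (2 ^+ k * x i 0))%:~R / 2 ^+ k])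
        (dyadic k @^-1` [set j]).
    apply/seteqP; split => [x /=|x [k _ [_ [y ry <-]]]]; last first.
      move=> /dyadicP/(_ i) xy; move: ry; rewrite /= in_itv/= andbT -xy.
      move=> /lt_le_trans; apply; rewrite ler_pdivrMr ?exprn_gt0//.
      by rewrite mulrC floor_le.
    rewrite in_itv/= andbT -subr_gt0 => xr.
    have [k _ /= /(_ k (leqnn k))] :=
      near_infty_natSinv_expn_lt (PosNum xr).
    rewrite div1r => xk; exists k => //; exists (dyadic k x) => //.
    exists x => //=; rewrite ltr_pdivlMr ?exprn_gt0//.
    have := floorD1_gt (2 ^+ k * x i 0); rewrite intrD -ltrBlDr.
    apply: le_lt_trans; rewrite -(ler_pM2r (_ : 0 < (2 ^+ k)^-1));
      last by rewrite invr_gt0 exprn_gt0.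
    rewrite mulfK ?expf_neq0// mulrBl mulrAC divff ?expf_neq0//.
    by move: xk; rewrite !mul1r; lra.
  apply: bigcupT_measurable => k; apply: bigcup_measurable => j _.
  by apply: sub_sigma_algebra; exists k, j.
by move=> /(_ measurableT B mB); rewrite setTI.
Qed.

End dyadic.

(** * Images of Lebesgue measure under expanding maps *)

Lemma ge0_integral_mrestr d (T : measurableType d) (R : realType)
    (mu : {measure set T -> \bar R}) (D : set T) (mD : measurable D)
    (f : T -> \bar R) :
  measurable_fun setT f -> (forall x, 0 <= f x)%E ->
  (\int[mrestr mu mD]_x f x = \int[mu]_(x in D) f x)%E.
Proof.
move=> mf f0; rewrite -(setUCr D) ge0_integral_setU//; last 3 first.
- exact: measurableC.
- by rewrite setUCr.
- by rewrite /disj_set setICr.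
rewrite (eq_measure_integral (D := D) mu)//; last first.
  by move=> A mA AD; rewrite /= /mrestr setIidl.
rewrite (eq_measure_integral (D := ~` D) mzero).
  by rewrite integral_measure_zero adde0.
by move=> A mA /disjoints_subset AD; rewrite /= /mrestr AD measure0.
Qed.

Section lipschitz.
Local Open Scope ereal_scope.
Context {R : realType} {n : nat}.
Notation E := 'cV[R]_n.
Notation lambda := (lebesgue_cV R n).

(* If [|x - y| <= c |G x - G y|], the preimage under [G] of a cube of side [s]
   lies in a half-open cube of side [3 c n s]. *)
Definition dilation (c : R) : R := ((3 * c * n%:R) ^+ n)%R.

Lemma dilation_ge0 c : (0 <= c)%R -> (0 <= dilation c)%R.
Proof. by move=> c0; rewrite exprn_ge0// !mulr_ge0. Qed.

Variables (K : set E) (G : E -> E) (c : R).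
Hypotheses (mK : measurable K) (mG : measurable_fun setT G) (c_gt0 : (0 < c)%R)
  (lipG : forall x y, K x -> K y -> (enorm (x - y) <= c * enorm (G x - G y))%R).

Let nu := pushforward (mrestr lambda mK) G.

HB.instance Definition _ := Measure.copy nu
  (measure_function_pushforward__canonical__measure_function_Measure
    (mrestr lambda mK) mG).

(** Once one point y of the preimage is fixed, every other one has its image within [n%:R * s] of
    that of y, so it lies within c times this distance of y. *)
Lemma preimage_cube_le (a : E) s : (0 < s)%R ->
  lambda (G @^-1` cube a s `&` K) <= (dilation c * s ^+ n)%:E.
Proof.
move=> s0; set A := _ `&` _.
have [->|/set0P[y [Gy Ky]]] := eqVneq A set0.
  by rewrite measure0 lee_fin mulr_ge0 ?dilation_ge0 ?exprn_ge0// ltW.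
have mA : measurable A.
  apply: measurableI => //; rewrite -[X in measurable X]setTI.
  by apply: mG => //; exact: measurable_cube.
pose t := (c * (n%:R * s))%R.
(* Side 3t rather than 2t: the half-open cube must contain the points with a coordinate equal to
   that of y plus t. *)
have At : A `<=` cube (y - const_mx t) (3 * t).
  move=> x [Gx Kx] i; rewrite !mxE.
  have : (`|x i 0 - y i 0| <= t)%R.
    have := coord_le_enorm (x - y) i; rewrite !mxE => /le_trans; apply.
    apply: (le_trans (lipG Kx Ky)); rewrite ler_pM2l//.
    apply: enorm_le_coord => j; rewrite !mxE ler_norml.
    have := Gx j; have := Gy j; lra.
  have t0 : (0 < t)%R.
    by rewrite !mulr_gt0// ltr0n (leq_ltn_trans _ (ltn_ord i)).
  by rewrite ler_norml; lra.
have /le_trans -> // : lambda A <= lambda (cube (y - const_mx t) (3 * t)%R).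
  by apply: le_measure; rewrite ?inE//; exact: measurable_cube.
rewrite lebesgue_cube; last by rewrite !mulr_ge0// ltW.
by rewrite /dilation -exprMn /t !mulrA.
Qed.

(** By [le_measure_cells] it is enough to compare the two measures on dyadic cubes, where
    [preimage_cube_le] applies. *)
Lemma lipschitz_measure_le A : measurable A ->
  lambda (G @^-1` A `&` K) <= (dilation c)%:E * lambda A.
Proof.
have C0 := dilation_ge0 (ltW c_gt0).
pose mu := mscale (NngNum C0) lambda.
have -> : lambda (G @^-1` A `&` K) = nu A by [].
have muE B : mu B = (dilation c)%:E * lambda B by [].
rewrite -muE.
apply: (@le_measure_cells _ _ _ mu nu dyadic) => {A}.
- exact: measurable_dyadic_cell.
- exact: dyadicS.
- exact: dyadic_generates.
- move=> i; have [->|[x <-]] := dyadic_cell_empty (R := R) (n := n) 0 i.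
    by rewrite measure0.
  rewrite -[X in X < _]/((dilation c)%:E * lambda (dyadic 0 @^-1` _)).
  by rewrite dyadic_cell lebesgue_cube ?invr_ge0 ?exprn_ge0// -EFinM ltry.
- move=> k i; have [->|[x <-]] := dyadic_cell_empty (R := R) (n := n) k i.
    by rewrite !measure0.
  rewrite -[X in _ <= X]/((dilation c)%:E * lambda (dyadic k @^-1` _)).
  rewrite dyadic_cell lebesgue_cube ?invr_ge0 ?exprn_ge0//.
  by apply: preimage_cube_le; rewrite invr_gt0 exprn_gt0.
Qed.

(** This replaces the change of variables formula throughout, without derivatives or Jacobians: the
    image measure of Lebesgue measure on [K] is dominated by a multiple of Lebesgue measure. *)
Lemma lipschitz_integral_le (L : set E) (F : E -> \bar R) :
  measurable L -> (forall x, K x -> L (G x)) ->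
  measurable_fun setT F -> (forall x, 0 <= F x) ->
  \int[lambda]_(x in K) F (G x) <= (dilation c)%:E * \int[lambda]_(x in L) F x.
Proof.
move=> mL KL mF F0.
have C0 := dilation_ge0 (ltW c_gt0).
pose mu := mscale (NngNum C0) lambda.
have mFL : measurable_fun setT (F \_ L).
  by apply/(measurable_restrictT _ _).1 => //; exact: measurable_funS mF.
have FL0 y : 0 <= (F \_ L) y by rewrite patchE; case: ifP.
have -> : \int[lambda]_(x in K) F (G x) = \int[nu]_y (F \_ L) y.
  rewrite ge0_integral_pushforward//= preimage_setT ge0_integral_mrestr//=.
    apply: eq_integral => x; rewrite inE => Kx.
    by rewrite /= patchE mem_set//; exact: KL.
  exact: measurableT_comp mFL mG.
apply: (@le_trans _ _ (\int[mu]_y (F \_ L) y)).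
  by apply: ge0_le_measure_integral => // A mA; exact: lipschitz_measure_le.
by rewrite ge0_integral_mscale//= -integral_mkcond.
Qed.

End lipschitz.
Arguments dilation {R} n c.

(** * Iterated integrals and measurability *)

Section tonelli_in.
Local Open Scope ereal_scope.
Context d1 d2 (T1 : measurableType d1) (T2 : measurableType d2) (R : realType).
Variables (m1 : {sigma_finite_measure set T1 -> \bar R})
  (m2 : {sigma_finite_measure set T2 -> \bar R}) (f : T1 -> T2 -> \bar R).
Hypotheses (mf : measurable_fun setT (fun p => f p.1 p.2))
  (f0 : forall x y, 0 <= f x y).

Lemma measurable_integral_in B : measurable B ->
  measurable_fun setT (fun x => \int[m2]_(y in B) f x y).
Proof.
move=> mB; pose g := (fun p : T1 * T2 => f p.1 p.2) \_ (setT `*` B).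
have gE x y : g (x, y) = (f x \_ B) y.
  by rewrite /g !patchE in_setX in_setT.
have mg : measurable_fun setT g.
  apply/(measurable_restrictT _ _).1; first exact: measurableX.
  exact: measurable_funS mf.
have g0 p : 0 <= g p by rewrite /g patchE; case: ifP.
have := measurable_fun_fubini_tonelli_F (m2 := m2) _ mg g0.
apply: eq_measurable_fun => x _; rewrite [RHS]integral_mkcond.
by apply: eq_integral => y _; rewrite gE.
Qed.

Lemma tonelli_in A B : measurable A -> measurable B ->
  \int[m1]_(x in A) \int[m2]_(y in B) f x y =
  \int[m2]_(y in B) \int[m1]_(x in A) f x y.
Proof.
move=> mA mB; pose g := (fun p : T1 * T2 => f p.1 p.2) \_ (A `*` B).
have mg : measurable_fun setT g.
  apply/(measurable_restrictT _ _).1; first exact: measurableX.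
  exact: measurable_funS mf.
have g0 p : 0 <= g p by rewrite /g patchE; case: ifP.
have gE x y : g (x, y) = if (x \in A) && (y \in B) then f x y else 0.
  by rewrite /g patchE in_setX.
transitivity (\int[m1]_x \int[m2]_y g (x, y)).
  rewrite integral_mkcond; apply: eq_integral => x _; rewrite patchE.
  case: ifPn => xA; last first.
    by rewrite integral0_eq// => y _; rewrite gE (negbTE xA).
  rewrite integral_mkcond; apply: eq_integral => y _.
  by rewrite gE xA patchE.
rewrite fubini_tonelli// [RHS]integral_mkcond; apply: eq_integral => y _.
rewrite patchE; case: ifPn => yB; last first.
  by rewrite integral0_eq// => x _; rewrite gE (negbTE yB) andbF.
rewrite [RHS]integral_mkcond; apply: eq_integral => x _.
by rewrite gE yB andbT patchE.
Qed.

End tonelli_in.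

Section tonelli3.
Local Open Scope ereal_scope.
Context d1 d2 d3 (T1 : measurableType d1) (T2 : measurableType d2)
  (T3 : measurableType d3) (R : realType).
Variables (m1 : {sigma_finite_measure set T1 -> \bar R})
  (m2 : {sigma_finite_measure set T2 -> \bar R})
  (m3 : {sigma_finite_measure set T3 -> \bar R}) (F : T1 -> T2 -> T3 -> \bar R).
Hypotheses (mF : measurable_fun setT (fun p => F p.1.1 p.1.2 p.2))
  (F0 : forall x y z, 0 <= F x y z).

Let measurable_F d (X : measurableType d) (x : X -> T1) (y : X -> T2)
    (z : X -> T3) :
  measurable_fun setT x -> measurable_fun setT y -> measurable_fun setT z ->
  measurable_fun setT (fun t => F (x t) (y t) (z t)).
Proof.
move=> mx my mz.
have mp : measurable_fun setT (fun t => ((x t, y t), z t)).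
  by apply: measurable_fun_pair => //; exact: measurable_fun_pair.
exact: measurableT_comp mF mp.
Qed.

Let measurable_11 d4 (T4 : measurableType d4) d5 (T5 : measurableType d5)
    d6 (T6 : measurableType d6) :
  measurable_fun setT (fun p : (T4 * T5) * T6 => p.1.1).
Proof. exact: measurableT_comp measurable_fst measurable_fst. Qed.

Let measurable_12 d4 (T4 : measurableType d4) d5 (T5 : measurableType d5)
    d6 (T6 : measurableType d6) :
  measurable_fun setT (fun p : (T4 * T5) * T6 => p.1.2).
Proof. exact: measurableT_comp measurable_snd measurable_fst. Qed.

Let measurable_in_y B : measurable B ->
  measurable_fun setT (fun p => \int[m2]_(y in B) F p.1 y p.2).
Proof.
move=> mB; apply: (@measurable_integral_in _ _ _ _ _ m2
  (fun (p : T1 * T3) y => F p.1 y p.2)) => //.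
apply: measurable_F; first exact: measurable_11.
  exact: measurable_snd.
exact: measurable_12.
Qed.

Lemma measurable_integral_xy A B : measurable A -> measurable B ->
  measurable_fun setT (fun z => \int[m1]_(x in A) \int[m2]_(y in B) F x y z).
Proof.
move=> mA mB; apply: (@measurable_integral_in _ _ _ _ _ m1
  (fun z x => \int[m2]_(y in B) F x y z)) => //; last first.
  by move=> z x; exact: integral_ge0.
have ms : measurable_fun setT (fun p : T3 * T1 => (p.2, p.1)).
  exact: measurable_fun_pair.
exact: measurableT_comp (measurable_in_y mB) ms.
Qed.

Lemma measurable_integral_yz B C : measurable B -> measurable C ->
  measurable_fun setT (fun x => \int[m2]_(y in B) \int[m3]_(z in C) F x y z).
Proof.
move=> mB mC; apply: (@measurable_integral_in _ _ _ _ _ m2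
  (fun x y => \int[m3]_(z in C) F x y z)) => //; last first.
  by move=> x y; exact: integral_ge0.
exact: (@measurable_integral_in _ _ _ _ _ m3
  (fun (p : T1 * T2) z => F p.1 p.2 z)).
Qed.

(** Two exchanges carry the innermost variable past the other two. *)
Lemma tonelli3 A B C : measurable A -> measurable B -> measurable C ->
  \int[m1]_(x in A) \int[m2]_(y in B) \int[m3]_(z in C) F x y z =
  \int[m3]_(z in C) \int[m1]_(x in A) \int[m2]_(y in B) F x y z.
Proof.
move=> mA mB mC.
transitivity (\int[m1]_(x in A) \int[m3]_(z in C) \int[m2]_(y in B) F x y z).
  apply: eq_integral => x _; apply: tonelli_in => //.
  by apply: measurable_F => //; exact: measurable_cst.
apply: (@tonelli_in _ _ _ _ _ m1 m3
  (fun x z => \int[m2]_(y in B) F x y z)) => //.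
  exact: measurable_in_y.
by move=> x z; exact: integral_ge0.
Qed.

End tonelli3.

(** * Measurability of vector operations *)

Section measurable_cV_ops.
Context d (T : measurableType d) (R : realType) (n : nat).
Implicit Types (u v : T -> 'cV[R]_n) (f g : T -> R).

Lemma measurable_cVD u v : measurable_fun setT u -> measurable_fun setT v ->
  measurable_fun setT (fun t => u t + v t).
Proof.
move=> /measurable_fun_cVP mu /measurable_fun_cVP mv.
apply/measurable_fun_cVP => i.
apply: (eq_measurable_fun (fun t => u t i 0 + v t i 0)).
  by move=> t _; rewrite mxE.
exact: measurable_funD.
Qed.

Lemma measurable_cVZ f u : measurable_fun setT f -> measurable_fun setT u ->
  measurable_fun setT (fun t => f t *: u t).
Proof.
move=> mf /measurable_fun_cVP mu; apply/measurable_fun_cVP => i.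
apply: (eq_measurable_fun (fun t => f t * u t i 0)).
  by move=> t _; rewrite mxE.
exact: measurable_funM.
Qed.

Lemma measurable_cVB u v : measurable_fun setT u -> measurable_fun setT v ->
  measurable_fun setT (fun t => u t - v t).
Proof.
move=> mu mv; under eq_fun do rewrite -scaleN1r.
by apply: measurable_cVD => //; exact: measurable_cVZ.
Qed.

Lemma measurable_dotp u v : measurable_fun setT u -> measurable_fun setT v ->
  measurable_fun setT (fun t => dotp (u t) (v t)).
Proof.
move=> /measurable_fun_cVP mu /measurable_fun_cVP mv.
by apply: measurable_sum => i; exact: measurable_funM.
Qed.

Lemma measurable_enorm_comp u : measurable_fun setT u ->
  measurable_fun setT (fun t => enorm (u t)).
Proof. exact: measurableT_comp measurable_enorm. Qed.

Lemma measurable_radial_comp u : measurable_fun setT u ->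
  measurable_fun setT (fun t => radial (u t)).
Proof. exact: measurableT_comp measurable_radial. Qed.

Lemma measurable_abs_diff f g :
  measurable_fun setT f -> measurable_fun setT g ->
  measurable_fun setT (fun t => `|f t - g t|%:E).
Proof.
move=> mf mg; apply/measurable_EFinP.
by apply: measurableT_comp => //; exact: measurable_funB.
Qed.

Lemma measurable_mulmx (M : 'M[R]_n) u : measurable_fun setT u ->
  measurable_fun setT (fun t => M *m u t).
Proof.
move=> /measurable_fun_cVP mu; apply/measurable_fun_cVP => i.
apply: (eq_measurable_fun (fun t => \sum_j M i j * u t j 0)).
  by move=> t _; rewrite mxE.
by apply: measurable_sum => j; exact: measurable_funM.
Qed.

End measurable_cV_ops.

(** * Volumes of Euclidean balls *)

Section balls.
Local Open Scope ereal_scope.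
Context {R : realType} {n : nat}.
Notation lambda := (lebesgue_cV R n).

(** The side 4r leaves room for the boundary points that a half-open cube of side 2r would miss. *)
Lemma lebesgue_enball_le r : (0 < r)%R ->
  lambda (enball R n r) <= ((4 * r) ^+ n)%:E.
Proof.
move=> r0.
have rc : enball R n r `<=` cube (const_mx (- r)%R) (4 * r).
  move=> x; rewrite /enball /= => xr i; rewrite mxE.
  have := coord_le_enorm x i; rewrite ler_norml; lra.
rewrite -(@lebesgue_cube R n (const_mx (- r)%R)); last first.
  by rewrite mulr_ge0// ltW.
apply: le_measure => //; rewrite inE; first exact: measurable_enball.
exact: measurable_cube.
Qed.

Lemma measurable_eball (c : 'cV[R]_n) r :
  measurable [set x | enorm (x - c) <= r]%R.
Proof.
rewrite (_ : mkset _ = setT `&` (fun x => enorm (x - c)) @^-1` `]-oo, r]).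
  by apply: measurable_enorm_comp => //; exact: measurable_cVB.
by rewrite setTI; apply/seteqP; split => x /=; rewrite in_itv.
Qed.

(** A cube of side [r / n%:R] with its lower corner at the centre fits into the ball. *)
Lemma lebesgue_eball_ge (c : 'cV[R]_n) r : (0 < n)%N -> (0 <= r)%R ->
  ((r / n%:R) ^+ n)%:E <= lambda [set x | enorm (x - c) <= r]%R.
Proof.
move=> n0 r0; have s0 : (0 <= r / n%:R)%R by rewrite divr_ge0.
rewrite -(@lebesgue_cube R n c)//.
apply: le_measure; rewrite ?inE; [exact: measurable_cube|
  exact: measurable_eball|].
move=> x cx /=; have -> : r = (n%:R * (r / n%:R))%R.
  by rewrite mulrCA divff ?mulr1// pnatr_eq0 -lt0n.
apply: enorm_le_coord => i; rewrite !mxE ler_norml; have := cx i; lra.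
Qed.

Lemma lebesgue_enball_ge r : (0 < n)%N -> (0 <= r)%R ->
  ((r / n%:R) ^+ n)%:E <= lambda (enball R n r).
Proof.
move=> n0 r0; rewrite (_ : enball R n r = [set x | enorm (x - 0) <= r]%R).
  exact: lebesgue_eball_ge.
by apply/seteqP; split => x /=; rewrite subr0.
Qed.

End balls.

(** * Norm preserving maps and radial shifts *)

Section euclid_maps.
Context {R : realType} {n : nat}.
Implicit Types (x y h u v w : 'cV[R]_n).

(** Rescaling y to the length of x moves it by at most the difference of the lengths, hence by at
    most [enorm (x - y)]. *)
Lemma enorm_sub_scale x y :
  enorm x * enorm (radial x - radial y) <= 2 * enorm (x - y).
Proof.
rewrite -{1}(ger0_norm (enorm_ge0 x)) -enormZ scalerBr enorm_radialK.
rewrite (le_trans (enorm_subD y _ _))// mulr2n mulrDl mul1r lerD2l.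
rewrite -{1}(enorm_radialK y) -scalerBl enormZ.
have [->|y0] := eqVneq y 0.
  by rewrite /radial scaler0 enorm0 mulr0 enorm_ge0.
by rewrite enorm_radial// mulr1 enormBC dist_enorm.
Qed.

(** Split x - y into a change of direction, scaled by |x|, and a change of length. Since [T]
    preserves lengths, the second part is at most |T x - T y|. The first is controlled by the
    hypothesis on directions followed by [enorm_sub_scale] for T x and T y, which yields 2c. *)
Lemma expanding_of_radial (T : 'cV[R]_n -> 'cV[R]_n) (c : R) : 0 <= c ->
  (forall x, enorm (T x) = enorm x) ->
  (forall x y, x != 0 -> y != 0 ->
    enorm (radial x - radial y) <= c * enorm (radial (T x) - radial (T y))) ->
  forall x y, enorm (x - y) <= (1 + 2 * c) * enorm (T x - T y).
Proof.
move=> c0 nT rT x y.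
have TE : `|enorm x - enorm y| <= enorm (T x - T y).
  by rewrite -(nT x) -(nT y) dist_enorm.
have N0 := enorm_ge0 (T x - T y).
have cN : 0 <= 2 * c * enorm (T x - T y) by rewrite !mulr_ge0.
have [x0|x0] := eqVneq x 0.
  move: N0 cN TE; rewrite x0 enorm0 !sub0r enormN normrN.
  by rewrite ger0_norm ?enorm_ge0//; lra.
have [y0|y0] := eqVneq y 0.
  move: N0 cN TE; rewrite y0 enorm0 !subr0.
  by rewrite ger0_norm ?enorm_ge0//; lra.
have -> : x - y = enorm x *: (radial x - radial y) +
    (enorm x - enorm y) *: radial y.
  by rewrite scalerBr scalerBl !enorm_radialK addrA subrK.
rewrite (le_trans (enormD _ _))// (enormZ (enorm x)) (enormZ (_ - _)).
rewrite enorm_radial// mulr1 (ger0_norm (enorm_ge0 x)).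
have := rT _ _ x0 y0; have := enorm_sub_scale (T x) (T y).
rewrite nT => H1 H2.
have H3 : enorm x * enorm (radial x - radial y) <=
    enorm x * (c * enorm (radial (T x) - radial (T y))).
  by apply: ler_wpM2l => //; exact: enorm_ge0.
have H4 : c * (enorm x * enorm (radial (T x) - radial (T y))) <=
    c * (2 * enorm (T x - T y)).
  exact: ler_wpM2l.
by lra.
Qed.

Lemma radialK x : radial (radial x) = radial x.
Proof.
have [->|x0] := eqVneq x 0; first by rewrite /radial !scaler0.
by apply: radial_sphere; rewrite /sphere/= enorm_radial.
Qed.

Lemma radialN x : radial (- x) = - radial x.
Proof. by rewrite /radial enormN scalerN. Qed.

(** The point x + |x|h put back on the sphere of radius |x|. A 0-homogeneous function takes the same
    value at both when x is nonzero, while for |h| < 1 this map also preserves the punctured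
    ball. *)
Definition shift h x : 'cV[R]_n := enorm x *: radial (x + enorm x *: h).

Lemma shift_arg_neq0 h x : enorm h < 1 -> x != 0 -> x + enorm x *: h != 0.
Proof.
move=> h1 x0; apply/eqP => /eqP; rewrite addr_eq0 => /eqP xh.
have : enorm x = enorm x * enorm h.
  by rewrite {1}xh enormN enormZ ger0_norm ?enorm_ge0.
have : 0 < enorm x by rewrite enorm_gt0.
by move: (enorm x) (enorm h) h1 => a b ?; nra.
Qed.

Lemma enorm_shift h x : enorm h < 1 -> enorm (shift h x) = enorm x.
Proof.
move=> h1; rewrite /shift enormZ ger0_norm ?enorm_ge0//.
have [->|x0] := eqVneq x 0; first by rewrite enorm0 mul0r.
by rewrite enorm_radial ?mulr1// shift_arg_neq0.
Qed.

Lemma shift_near h x : enorm h < 1 ->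
  enorm (shift h x - x) <= 2 * enorm h * enorm x.
Proof.
move=> h1; have [->|x0] := eqVneq x 0.
  by rewrite /shift enorm0 scale0r subrr enorm0 mulr0.
have := enorm_sub_scale x (x + enorm x *: h).
rewrite opprD addNKr enormN enormZ (ger0_norm (enorm_ge0 x)).
rewrite -{1}(ger0_norm (enorm_ge0 x)) -enormZ scalerBr enorm_radialK enormBC.
by rewrite /shift; lra.
Qed.

(* With [x + h = s a] and [|a| = 1], the equation [|s a - h| = 1] reads
   [s - (1 - |h|^2) / s = 2 a.h], so that [s] is 2-Lipschitz in [a]
   uniformly in [|h| < 1]. *)
Lemma radial_shift_expanding h x y :
  enorm h < 1 -> enorm x = 1 -> enorm y = 1 ->
  enorm (x - y) <= 4 * enorm (radial (x + h) - radial (y + h)).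
Proof.
move=> h1 x1 y1.
have pos z : enorm z = 1 -> 0 < enorm (z + h).
  by move=> z1; have := enorm_sub_ge z (- h); rewrite opprK enormN z1; lra.
have le2 z : enorm z = 1 -> enorm (z + h) <= 2.
  by move=> z1; have := enormD z h; rewrite z1; lra.
have eqn z : enorm z = 1 -> enorm (z + h) ^+ 2 + enorm h ^+ 2 - 1 =
    2 * (enorm (z + h) * dotp (radial (z + h)) h).
  move=> z1; rewrite -dotpZl enorm_radialK -{1}(addrK h z) in z1 *.
  have : enorm (z + h - h) ^+ 2 = 1 by rewrite z1 expr1n.
  rewrite !enorm_sqr !dotpE (dotpC h z); lra.
have s0 := pos x x1; have t0 := pos y y1.
have s2 := le2 x x1; have es := eqn x x1; have et := eqn y y1.
set a := radial (x + h) in es *; set b := radial (y + h) in et *.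
set s := enorm (x + h) in es s0 s2 *; set t := enorm (y + h) in et t0 *.
have b1 : enorm b = 1.
  by apply: enorm_radial; rewrite -enorm_gt0.
have hab : `|dotp (a - b) h| <= enorm (a - b).
  have ab0 := enorm_ge0 (a - b); have hge0 := enorm_ge0 h.
  have := dotp_le (a - b) h; have := dotp_le (- (a - b)) h.
  by rewrite enormN dotpNl ler_norml; nra.
have st : `|s - t| <= 2 * enorm (a - b).
  have e0 : 0 <= 1 - enorm h ^+ 2.
    by rewrite subr_ge0 expr_le1 ?enorm_ge0// ltW.
  set e := 1 - enorm h ^+ 2 in e0.
  (* Multiply the equation of s by t, that of t by s, and subtract. Since [e] is nonnegative,
     dividing by s t + e costs no more than dividing by s t. *)
  have key : (s - t) * (s * t + e) = 2 * (s * t) * dotp (a - b) h.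
    have E1 : s ^+ 2 - e = 2 * (s * dotp a h) by rewrite -es /e; ring.
    have E2 : t ^+ 2 - e = 2 * (t * dotp b h) by rewrite -et /e; ring.
    have -> : 2 * (s * t) * dotp (a - b) h =
        t * (2 * (s * dotp a h)) - s * (2 * (t * dotp b h)).
      by rewrite !dotpE; ring.
    by rewrite -E1 -E2; ring.
  have st0 : 0 < s * t by rewrite mulr_gt0.
  have : `|s - t| * (s * t) <= 2 * enorm (a - b) * (s * t).
    apply: (@le_trans _ _ (`|s - t| * (s * t + e))).
      by apply: ler_wpM2l => //; rewrite lerDl.
    rewrite -{1}(ger0_norm (addr_ge0 (ltW st0) e0)).
    rewrite -normrM key !normrM (ger0_norm (ltW s0)) (ger0_norm (ltW t0)).
    rewrite normr_nat (mulrAC 2 (enorm _)).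
    by apply: ler_wpM2l => //; rewrite mulr_ge0// ltW.
  by rewrite (ler_pM2r st0).
(* The constant 4 is the bound 2 on s plus the Lipschitz constant 2. *)
have -> : x - y = s *: (a - b) + (s - t) *: b.
  rewrite scalerBr scalerBl !enorm_radialK -/s -/t.
  by rewrite addrA subrK opprD addrACA subrr addr0.
rewrite (le_trans (enormD _ _))// (enormZ s) (enormZ (s - t)) b1 mulr1.
rewrite ger0_norm ?(ltW s0)//.
by have := enorm_ge0 (a - b); nra.
Qed.

Lemma shift_expanding h x y : enorm h < 1 ->
  enorm (x - y) <= 9 * enorm (shift h x - shift h y).
Proof.
move=> h1; have -> : (9 : R) = 1 + 2 * 4 by ring.
apply: expanding_of_radial => //; first by move=> z; exact: enorm_shift.
move=> {}x {}y x0 y0.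
have rE z : z != 0 -> radial (shift h z) = radial (radial z + h).
  rewrite -enorm_gt0 => z0; rewrite /shift (radialZ _ z0) radialK.
  by rewrite -{1}(enorm_radialK z) -scalerDr (radialZ _ z0).
rewrite !rE//; apply: radial_shift_expanding => //; exact: enorm_radial.
Qed.

End euclid_maps.

(** * Reflections *)

Section reflections.
Context {R : realType} {n : nat}.
Implicit Types (a b u v w x y z : 'cV[R]_n).

(** The block matrix [M] factors both as lower times upper and as upper times lower triangular;
    compare the determinants of the two factorizations. *)
Lemma det_1D_mul (u : 'cV[R]_n) (v : 'rV[R]_n) :
  \det (1%:M + u *m v) = 1 + (v *m u) 0 0.
Proof.
pose M := block_mx (1%:M : 'M[R]_1) (- v) u (1%:M : 'M[R]_n).
have M1 : M = block_mx 1%:M 0 u 1%:M *m block_mx 1%:M (- v) 0 (1%:M + u *m v).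
  rewrite mulmx_block !mul1mx !mulmx1 !mul0mx ?mulmx0 !addr0.
  by rewrite mulmxN addrCA addNr addr0.
have M2 : M = block_mx 1%:M (- v) 0 1%:M *m block_mx (1%:M + v *m u) 0 u 1%:M.
  rewrite mulmx_block !mul1mx !mulmx1 !mul0mx ?mulmx0 !add0r.
  by rewrite mulNmx addrK.
have := congr1 determinant M1; rewrite M2 !det_mulmx !det_lblock !det_ublock.
by rewrite !det1 !mul1r !mulr1 det_mx11 !mxE => <-.
Qed.

Lemma dotp_mulmx x y : dotp x y = (x^T *m y) 0 0.
Proof. by rewrite mxE; apply: eq_bigr => i _; rewrite mxE. Qed.

(** Reflection in the hyperplane orthogonal to [a]. It is the identity at [a = 0], where [radial a]
    vanishes. *)
Definition refl a x : 'cV[R]_n := x - (2 * dotp (radial a) x) *: radial a.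

Definition refl_mx a : 'M[R]_n := 1%:M + (- 2 *: radial a) *m (radial a)^T.

Lemma refl_mxE a x : refl_mx a *m x = refl a x.
Proof.
rewrite /refl mulmxDl mul1mx -mulmxA; congr (_ + _).
rewrite [_^T *m x]mx11_scalar -dotp_mulmx mul_mx_scalar scalerA -scaleNr.
by congr (_ *: _); ring.
Qed.

(** This form covers both a unit normal and the zero one, so that the reflection identities hold for
    every [a]. *)
Lemma dotp_radial_idem a x :
  dotp (radial a) (radial a) * dotp (radial a) x = dotp (radial a) x.
Proof.
have [->|a0] := eqVneq a 0.
  by rewrite /radial scaler0 -(scale0r 0) !dotpZl !mul0r.
by rewrite -enorm_sqr enorm_radial// expr1n mul1r.
Qed.

Lemma dotp_refl a x y : dotp (refl a x) (refl a y) = dotp x y.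
Proof.
have := dotp_radial_idem a x; have := dotp_radial_idem a y.
rewrite /refl; move: (radial a) => e; rewrite !dotpE (dotpC x e) => Hy Hx.
move: Hx Hy; move: (dotp e e) (dotp e x) (dotp e y) => d p q Hp Hq.
have : p * (d * q) = p * q by rewrite Hq.
lra.
Qed.

Lemma enorm_refl a x : enorm (refl a x) = enorm x.
Proof. by apply: eq_enorm; exact: dotp_refl. Qed.

Lemma reflK a : involutive (refl a).
Proof.
move=> x; rewrite /refl dotpDr dotpNr dotpZr -addrA -opprD -scalerDl.
have -> : 2 * dotp (radial a) x + 2 * (dotp (radial a) x -
    2 * dotp (radial a) x * dotp (radial a) (radial a)) = 0.
  by have := dotp_radial_idem a x; lra.
by rewrite scale0r subr0.
Qed.

Lemma reflB a x y : refl a (x - y) = refl a x - refl a y.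
Proof. by rewrite -!refl_mxE mulmxBr. Qed.

Lemma refl_mx_orthogonal a : refl_mx a *m (refl_mx a)^T = 1%:M.
Proof.
have symR : (refl_mx a)^T = refl_mx a.
  rewrite /refl_mx linearD/= trmx1 trmx_mul trmxK linearZ/=.
  by rewrite -scalemxAr -scalemxAl.
rewrite symR; apply/matrixP => i j.
have /colP/(_ i) := reflK a (col j 1%:M).
by rewrite -!refl_mxE mulmxA [in LHS]colE mul1mx -colE [LHS]mxE [RHS]mxE.
Qed.

Lemma det_refl_mx a : a != 0 -> \det (refl_mx a) = -1.
Proof.
move=> a0; rewrite det_1D_mul -dotp_mulmx dotpZr -enorm_sqr enorm_radial//.
by ring.
Qed.

Lemma rotation_refl a b : a != 0 -> b != 0 -> rotation (refl_mx a *m refl_mx b).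
Proof.
move=> a0 b0; split; last by rewrite det_mulmx !det_refl_mx// mulrNN mulr1.
rewrite trmx_mul mulmxA -(mulmxA (refl_mx a)) refl_mx_orthogonal mulmx1.
exact: refl_mx_orthogonal.
Qed.

Lemma enorm_rotation (rho : 'M[R]_n) x :
  rotation rho -> enorm (rho *m x) = enorm x.
Proof.
move=> [/mulmx1C rho1 _]; apply: eq_enorm.
by rewrite !dotp_mulmx trmx_mul mulmxA -(mulmxA x^T) rho1 mulmx1.
Qed.

Lemma enorm_radial_le a : enorm (radial a) <= 1.
Proof.
have [->|a0] := eqVneq a 0; first by rewrite /radial scaler0 enorm0.
by rewrite enorm_radial.
Qed.

(** As [refl a] is an isometric involution, the left side is the norm of [refl b z - refl a z],
    which is linear in the difference of the normals up to factors of norm at most 1. *)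
Lemma refl_near a b z :
  enorm (refl a (refl b z) - z) <= 4 * enorm (radial a - radial b) * enorm z.
Proof.
have E (e f : 'cV[R]_n) : z - (2 * dotp f z) *: f - (z - (2 * dotp e z) *: e) =
    (2 * dotp e z) *: (e - f) + (2 * dotp (e - f) z) *: f.
  by apply/colP => i; rewrite dotpDl dotpNl !mxE; ring.
rewrite -{2}(reflK a z) -reflB enorm_refl /refl E.
set a' := radial a; set b' := radial b.
rewrite (le_trans (enormD _ _))// (enormZ (2 * dotp a' z)) (enormZ (2 * _)).
rewrite !normrM normr_nat.
have z0 := enorm_ge0 z; have ab0 := enorm_ge0 (a' - b').
have dotp_norm x y : `|dotp x y| <= enorm x * enorm y.
  by rewrite ler_norml dotp_le andbT lerNl -dotpNl -(enormN x) dotp_le.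
have a1 := enorm_radial_le a; have b1 := enorm_radial_le b.
have H1 : `|dotp a' z| <= enorm z.
  by rewrite (le_trans (dotp_norm _ _))// ler_piMl.
have H2 := dotp_norm (a' - b') z.
have H3 : `|dotp a' z| * enorm (a' - b') <= enorm z * enorm (a' - b').
  exact: ler_wpM2r.
have H4 : `|dotp (a' - b') z| * enorm b' <= enorm (a' - b') * enorm z.
  rewrite -[leRHS]mulr1; apply: ler_pM => //; exact: enorm_ge0.
lra.
Qed.

(* A normal of the hyperplane whose reflection maps the direction of [w] to
   that of [u]. *)
Definition bisector w u : 'cV[R]_n := u - enorm u *: radial w.

(** The tolerance 1/4 is small enough for the bisector to be at least as long as [u] and for it to
    depend on [u] in an expanding way. *)
Definition opposite w : set 'cV[R]_n :=
  [set u | u != 0 /\ enorm (radial u + radial w) <= 4^-1].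

Lemma bisectorE w u : bisector w u = enorm u *: (radial u - radial w).
Proof. by rewrite scalerBr enorm_radialK. Qed.

(** The directions of u and w are nearly antipodal, hence at distance at least 2 - 1/4. *)
Lemma enorm_bisector_ge w u : w != 0 -> opposite w u ->
  enorm u <= enorm (bisector w u).
Proof.
move=> w0 [u0 uw]; rewrite bisectorE enormZ ger0_norm ?enorm_ge0//.
apply: ler_peMr; first exact: enorm_ge0.
have := enorm_sub_ge (2 *: radial u) (radial u + radial w).
rewrite enormZ normr_nat enorm_radial// (_ : _ - _ = radial u - radial w).
  lra.
by rewrite -[2]/(1 + 1) scalerDl scale1r opprD addrACA subrr add0r.
Qed.

Lemma bisector_neq0 w u : w != 0 -> opposite w u -> bisector w u != 0.
Proof.
move=> w0 uw; have [u0 _] := uw; rewrite -enorm_gt0.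
by apply: lt_le_trans (enorm_bisector_ge w0 uw); rewrite enorm_gt0.
Qed.

Lemma enorm_bisector_le w u : enorm (bisector w u) <= 2 * enorm u.
Proof.
rewrite (le_trans (enormB _ _))// mulr2n mulrDl mul1r lerD2l enormZ.
rewrite ger0_norm ?enorm_ge0//; apply: ler_piMr (enorm_radial_le _).
exact: enorm_ge0.
Qed.

Lemma bisectorB w u v : bisector w u - bisector w v =
  u - v - (enorm u - enorm v) *: radial w.
Proof.
rewrite /bisector; move: (radial w) => e.
by apply/colP => i; rewrite !mxE; ring.
Qed.

Lemma bisectorB_le w u v :
  enorm (bisector w u - bisector w v) <= 2 * enorm (u - v).
Proof.
rewrite bisectorB (le_trans (enormB _ _))// mulr2n mulrDl mul1r lerD2l enormZ.
apply: le_trans (dist_enorm u v).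
by apply: ler_piMr => //; exact: enorm_radial_le.
Qed.

(** A reflection whose normal is the difference of two unit vectors exchanges them. *)
Lemma refl_bisector w u : w != 0 -> u != 0 -> bisector w u != 0 ->
  refl (bisector w u) w = enorm w *: radial u.
Proof.
move=> w0 u0; rewrite bisectorE => d0.
rewrite /refl radialZ ?enorm_gt0//; set d := _ - _ in d0 *.
have {}d0 : d != 0 by apply: contra_neq d0 => ->; rewrite scaler0.
have dw : 2 * dotp d w = - (enorm w * enorm d ^+ 2).
  rewrite -{1}(enorm_radialK w) dotpZr enorm_sqr /d.
  have := enorm_radial u0; have := enorm_radial w0.
  move: (radial u) (radial w) => u' w' w1 u1.
  by rewrite !dotpE (dotpC w' u') -!enorm_sqr u1 w1; ring.
rewrite {1}/radial dotpZl {2}/radial scalerA.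
have -> : 2 * ((enorm d)^-1 * dotp d w) / enorm d = - enorm w.
  rewrite mulrCA dw; field; by rewrite enorm_eq0.
by rewrite scaleNr opprK /d scalerBr enorm_radialK addrCA subrr addr0.
Qed.

(** Write d = u - v, r = |u| - |v| and w' for the direction of w. Since u and v point almost along
    -w', the number r is close to -d.w', with an error of at most |d|/4. Hence |d - r w'|^2 = |d|^2
    - 2 r d.w' + r^2 is at least |d|^2 / 2. *)
Lemma bisector_expanding w u v : opposite w u -> opposite w v ->
  enorm (u - v) <= 2 * enorm (bisector w u - bisector w v).
Proof.
move=> [u0 uw] [v0 vw].
have [->|w0] := eqVneq w 0.
  rewrite /bisector /radial !scaler0 !subr0.
  by have := enorm_ge0 (u - v); lra.
rewrite bisectorB; move: uw vw (enorm_radial w0).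
move: (radial w) => w' uw vw w1.
set p := enorm u; set q := enorm v.
have p0 : 0 < p by rewrite enorm_gt0.
have q0 : 0 < q by rewrite enorm_gt0.
(* This vector is small by near opposition, and (u + v).(u - v) = p^2 - q^2 makes its product with d
   equal to p + q times the error r + d.w'. *)
pose e := u + v + (p + q) *: w'.
have e4 : enorm e <= 4^-1 * (p + q).
  have -> : e = p *: (radial u + w') + q *: (radial v + w').
    by rewrite !scalerDr !enorm_radialK /e scalerDl addrACA.
  rewrite (le_trans (enormD _ _))// (enormZ p) (enormZ q) !gtr0_norm//.
  have : p * enorm (radial u + w') <= p * 4^-1 by rewrite ler_pM2l.
  have : q * enorm (radial v + w') <= q * 4^-1 by rewrite ler_pM2l.
  lra.
pose d := u - v; pose r := p - q.
have E : (p + q) * (r + dotp w' d) = dotp e d.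
  rewrite /e !dotpDl dotpZl /d !dotpDr !dotpNr (dotpC v u).
  rewrite -!enorm_sqr -/p -/q /r.
  ring.
have rd : `|r + dotp w' d| <= 4^-1 * enorm d.
  have pq : 0 < p + q by rewrite addr_gt0.
  rewrite -(ler_pM2l pq) -{1}(gtr0_norm pq) -normrM E.
  have d0 := enorm_ge0 d.
  have : enorm e * enorm d <= 4^-1 * (p + q) * enorm d by exact: ler_wpM2r.
  have := dotp_le e d; have := dotp_le (- e) d.
  by rewrite enormN dotpNl ler_norml; lra.
have rle : `|r| <= enorm d by exact: dist_enorm.
rewrite -/d -/r; clear E; clearbody d r.
rewrite -ler_sqr ?nnegrE ?mulr_ge0 ?enorm_ge0// exprMn !enorm_sqr.
rewrite !dotpE (dotpC d w') -!enorm_sqr w1 expr1n.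
move: rd rle (enorm_ge0 d).
move: (dotp w' d) (enorm d) => s D.
rewrite !ler_norml => /andP[h1 h2] /andP[h3 h4] h5.
have : r * (r + s) <= 4^-1 * (D * D).
  have : `|r * (r + s)| <= D * (4^-1 * D).
    by rewrite normrM ler_pM// ler_norml; apply/andP.
  by rewrite ler_norml => /andP[_]; lra.
nra.
Qed.

End reflections.

(** * Averages over translations *)

Lemma ge0_le_integralT d (T : measurableType d) (R : realType)
    (mu : {measure set T -> \bar R}) (D : set T) (f1 f2 : T -> \bar R) :
  measurable D -> measurable_fun setT f1 -> measurable_fun setT f2 ->
  (forall x, 0 <= f1 x)%E -> (forall x, D x -> f1 x <= f2 x)%E ->
  (\int[mu]_(x in D) f1 x <= \int[mu]_(x in D) f2 x)%E.
Proof.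
move=> mD mf1 mf2 f10 f12.
by apply: ge0_le_integral => //; exact: measurable_funTS.
Qed.

Section averages.
Local Open Scope ereal_scope.
Context {R : realType} {n : nat} (g : 'cV[R]_n -> R).
Notation E := 'cV[R]_n.
Notation lambda := (lebesgue_cV R n).
Notation PB := (@punctured_ball R n).
Notation ball := (enball R n).
Hypotheses (mg : measurable_fun setT g)
  (ghom : forall (a : R) (x : E), (0 < a)%R -> g (a *: x)%R = g x).
Implicit Types (a h k u v w x y : E) (T : E -> E).

Lemma g_radial x : g (radial x) = g x.
Proof.
have [->|x0] := eqVneq x 0%R; first by rewrite /radial scaler0.
by rewrite -[RHS](congr1 g (enorm_radialK x)) ghom// enorm_gt0.
Qed.

(** When [T] is positively homogeneous, polar coordinates identify n times this integral with the
    one over the sphere. *)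
Definition displacement T := \int[lambda]_(x in PB) `|g (T x) - g x|%:E.

Definition kern x h := `|g (x + enorm x *: h)%R - g x|%:E.

(** The average written D in the overview. *)
Definition spread delta :=
  \int[lambda]_(x in PB) \int[lambda]_(h in ball delta) kern x h.

Lemma kern_ge0 x h : 0 <= kern x h.
Proof. by rewrite lee_fin. Qed.

Let mPB : measurable PB := @measurable_punctured_ball R n.
Let mball delta : measurable (ball delta) := measurable_enball delta.
#[local] Hint Resolve kern_ge0 mPB mball : core.

Lemma measurable_diff d (X : measurableType d) (u v : X -> E) :
  measurable_fun setT u -> measurable_fun setT v ->
  measurable_fun setT (fun t => `|g (u t) - g (v t)|%:E).
Proof.
move=> mu mv; apply: measurable_abs_diff; first exact: measurableT_comp mu.
exact: measurableT_comp mv.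
Qed.

Lemma measurable_push d (X : measurableType d) (u v : X -> E) :
  measurable_fun setT u -> measurable_fun setT v ->
  measurable_fun setT (fun t => u t + enorm (u t) *: v t)%R.
Proof.
move=> mu mv; apply: measurable_cVD => //; apply: measurable_cVZ => //.
exact: measurable_enorm_comp.
Qed.

Lemma measurable_kern d (X : measurableType d) (u v : X -> E) :
  measurable_fun setT u -> measurable_fun setT v ->
  measurable_fun setT (fun t => kern (u t) (v t)).
Proof.
by move=> mu mv; apply: measurable_diff => //; exact: measurable_push.
Qed.

Lemma measurable_spread_in delta : measurable_fun setT
  (fun x => \int[lambda]_(h in ball delta) kern x h).
Proof.
by apply: measurable_integral_in => //; exact: measurable_kern.
Qed.

Lemma le_spread d1 d2 : (d1 <= d2)%R -> spread d1 <= spread d2.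
Proof.
move=> d12; apply: ge0_le_integralT => //.
- exact: measurable_spread_in.
- exact: measurable_spread_in.
- by move=> x; exact: integral_ge0.
move=> x _; apply: ge0_subset_integral => //.
- by apply: measurable_funTS; exact: measurable_kern.
- by move=> h /= /le_trans; apply.
Qed.

(** After Tonelli, the inner integral at a fixed [h] is a displacement. *)
Lemma spread_le delta S :
  (forall h, (enorm h <= delta)%R ->
    displacement (fun x => x + enorm x *: h)%R <= S) ->
  spread delta <= S * lambda (ball delta).
Proof.
move=> dS; rewrite /spread tonelli_in//; last exact: measurable_kern.
rewrite -integral_cst//; apply: ge0_le_integralT => //.
- apply: (@measurable_integral_in _ _ _ _ _ lambda (fun h x => kern x h)) => //.
  exact: measurable_kern.
- by move=> h; exact: integral_ge0.
Qed.

(** In the constant, 1 accounts for the term [kern], [dilation n 1] for a translation in h, and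
    [dilation n c] for the substitution u = T x. The translation enlarges the radius by [eta]. *)
Lemma displacement_le_spread T (c eta delta : R) : measurable_fun setT T ->
  (0 < c)%R -> (0 <= eta)%R -> (forall x, enorm (T x) = enorm x) ->
  (forall x y, enorm (x - y) <= c * enorm (T x - T y))%R ->
  (forall x, enorm (T x - x) <= eta * enorm x)%R ->
  displacement T * lambda (ball delta) <=
    (1 + (dilation n 1 * dilation n c)%:E) * spread (delta + eta).
Proof.
move=> mT c0 eta0 nT eT nearT.
pose K1 x h := `|g (T x) - g (x + enorm x *: h)%R|%:E.
pose K2 u k := `|g u - g (u + enorm u *: k)%R|%:E.
have K10 x h : 0 <= K1 x h by rewrite lee_fin.
have K20 x h : 0 <= K2 x h by rewrite lee_fin.
have mK1 : measurable_fun setT (fun p => K1 p.1 p.2).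
  apply: measurable_diff; first exact: measurableT_comp mT measurable_fst.
  exact: measurable_push.
have mK2 : measurable_fun setT (fun p => K2 p.1 p.2).
  by apply: measurable_diff => //; exact: measurable_push.
have int0 (F : E -> E -> \bar R) d x : (forall x h, 0 <= F x h) ->
    0 <= \int[lambda]_(h in ball d) F x h.
  by move=> F0; exact: integral_ge0.
(* Triangle inequality through the value at x + |x|h, integrated over h. *)
have step1 : displacement T * lambda (ball delta) <=
    \int[lambda]_(x in PB) \int[lambda]_(h in ball delta) (K1 x h + kern x h).
  rewrite -ge0_integralZr//; last first.
    by apply: measurable_funTS; exact: measurable_diff.
  apply: ge0_le_integralT => //.
  - apply: emeasurable_funM => //; exact: measurable_diff.
  - apply: (@measurable_integral_in _ _ _ _ _ lambda
      (fun x h => K1 x h + kern x h)) => //.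
      by apply: emeasurable_funD => //; exact: measurable_kern.
    by move=> x h; rewrite adde_ge0.
  - by move=> x; rewrite mule_ge0.
  move=> x _; rewrite -integral_cst//; apply: ge0_le_integralT => //.
    apply: emeasurable_funD; last exact: measurable_kern.
    by apply: measurable_diff => //; exact: measurable_push.
    by move=> h; rewrite lee_fin.
  move=> h _; rewrite /K1 /kern -EFinD lee_fin.
  by rewrite (le_trans _ (ler_normD _ _))// addrA subrK.
(* Substitute k = h + (x - T x)/|x|, so that x + |x|h = T x + |T x|k. *)
have step2 x : PB x -> \int[lambda]_(h in ball delta) K1 x h <=
    (dilation n 1)%:E * \int[lambda]_(k in ball (delta + eta)) K2 (T x) k.
  move=> /andP[x0 _]; have x0' : x != 0%R by rewrite -enorm_gt0.
  pose G h := (h + (enorm x)^-1 *: (x - T x))%R.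
  have -> : \int[lambda]_(h in ball delta) K1 x h =
      \int[lambda]_(h in ball delta) K2 (T x) (G h).
    apply: eq_integral => h _; rewrite /K1 /K2 /G; congr (`|_ - g _|%:E)%R.
    rewrite nT scalerDr scalerA divff ?gt_eqF// scale1r.
    by rewrite [RHS]addrCA [(T x + _)%R]addrC subrK addrC.
  apply: lipschitz_integral_le => //.
  - by apply: measurable_cVD => //; exact: measurable_cst.
  - by move=> y z _ _; rewrite mul1r /G opprD addrACA subrr addr0.
  - move=> h /= hd; rewrite /enball/= (le_trans (enormD _ _))// lerD//.
    rewrite enormZ ger0_norm ?invr_ge0 ?enorm_ge0// enormBC.
    by rewrite ler_pdivrMl// mulrC.
  - by apply: measurable_diff => //; exact: measurable_push.
have step3 : \int[lambda]_(x in PB)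
      \int[lambda]_(k in ball (delta + eta)) K2 (T x) k <=
    (dilation n c)%:E * spread (delta + eta).
  have -> : spread (delta + eta) = \int[lambda]_(x in PB)
      \int[lambda]_(k in ball (delta + eta)) K2 x k.
    apply: eq_integral => x _; apply: eq_integral => h _.
    by rewrite /kern /K2 distrC.
  apply: (@lipschitz_integral_le _ _ PB T c mPB mT c0 _ PB
    (fun u => \int[lambda]_(k in ball (delta + eta)) K2 u k)) => //.
  - by move=> x; rewrite /punctured_ball/= nT.
  - exact: measurable_integral_in.
  - by move=> x; exact: int0.
apply: (le_trans step1).
have -> : \int[lambda]_(x in PB)
      \int[lambda]_(h in ball delta) (K1 x h + kern x h) =
    \int[lambda]_(x in PB) \int[lambda]_(h in ball delta) K1 x h + spread delta.
  rewrite -ge0_integralD//.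
  - apply: eq_integral => x _; rewrite ge0_integralD//; apply: measurable_funTS.
      by apply: measurable_diff => //; exact: measurable_push.
    exact: measurable_kern.
  - by move=> x _; exact: int0.
  - by apply: measurable_funTS; exact: measurable_integral_in.
  - by move=> x _; exact: int0.
  - by apply: measurable_funTS; exact: measurable_spread_in.
have D0 : 0 <= spread (delta + eta) by apply: integral_ge0 => x _; exact: int0.
have d1 : 0 <= (dilation n 1 : R)%:E by rewrite lee_fin dilation_ge0.
have d2 : (0 <= dilation n 1 * dilation n c)%R.
  by rewrite mulr_ge0 ?dilation_ge0 ?(ltW c0).
rewrite ge0_muleDl// mul1e.
rewrite addeC; apply: leeD; first by apply: le_spread; rewrite lerDl.
rewrite EFinM -muleA.
apply: le_trans (lee_wpmul2l d1 step3).
rewrite -ge0_integralZl//.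
- apply: ge0_le_integral => //.
  + by move=> x _; exact: int0.
  + by apply: measurable_funTS; exact: measurable_integral_in.
  + apply: measurable_funTS; apply: emeasurable_funM => //.
    exact: measurableT_comp (measurable_integral_in _ _ _ _) mT.
- apply: measurable_funTS.
  exact: measurableT_comp (measurable_integral_in _ _ _ _) mT.
- by move=> x _; exact: int0.
Qed.

End averages.

(** * Averages over reflections *)

Section rotation_averages.
Local Open Scope ereal_scope.
Context {R : realType} {n : nat} (g : 'cV[R]_n -> R).
Notation E := 'cV[R]_n.
Notation lambda := (lebesgue_cV R n).
Notation PB := (@punctured_ball R n).
Notation ball := (enball R n).
Hypotheses (mg : measurable_fun setT g)
  (ghom : forall (a : R) (x : E), (0 < a)%R -> g (a *: x)%R = g x).
Implicit Types (a h k u v w x y : E) (T : E -> E).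

Let mPB : measurable PB := @measurable_punctured_ball R n.
Let mball delta : measurable (ball delta) := measurable_enball delta.
#[local] Hint Resolve kern_ge0 mPB mball : core.

Lemma measurable_refl d (X : measurableType d) (u v : X -> E) :
  measurable_fun setT u -> measurable_fun setT v ->
  measurable_fun setT (fun t => refl (u t) (v t)).
Proof.
move=> mu mv; apply: measurable_cVB => //; apply: measurable_cVZ.
  apply: measurable_funM => //; apply: measurable_dotp => //.
  exact: measurable_radial_comp.
exact: measurable_radial_comp.
Qed.

Lemma measurable_bisector d (X : measurableType d) (w u : X -> E) :
  measurable_fun setT w -> measurable_fun setT u ->
  measurable_fun setT (fun t => bisector (w t) (u t)).
Proof.
move=> mw mu; apply: measurable_cVB => //; apply: measurable_cVZ.
  exact: measurable_enorm_comp.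
exact: measurable_radial_comp.
Qed.

Lemma measurable_opposite d (X : measurableType d) (w u : X -> E) :
  measurable_fun setT w -> measurable_fun setT u ->
  measurable [set t | opposite (w t) (u t)].
Proof.
move=> mw mu; rewrite (_ : mkset _ =
    (setT `&` (fun t => enorm (u t)) @^-1` `]0%R, +oo[) `&`
    (setT `&` (fun t => enorm (radial (u t) + radial (w t)))
      @^-1` `]-oo, 4^-1%R])).
  apply: measurableI; first exact: measurable_enorm_comp.
  apply: measurable_enorm_comp => //.
  by apply: measurable_cVD; exact: measurable_radial_comp.
apply/seteqP; split => t /=; rewrite !in_itv/= andbT enorm_gt0; first by case.
by move=> [[_ ?] [_ ?]].
Qed.

(** The second normal is written a + |a|k, so that |k| measures the relative distance between the
    two normals. *)
Definition refl_diff w a k :=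
  `|g (refl (a + enorm a *: k) w) - g (refl a w)|%:E.

Lemma refl_diff_ge0 w a k : 0 <= refl_diff w a k.
Proof. by rewrite lee_fin. Qed.
#[local] Hint Resolve refl_diff_ge0 : core.

Lemma measurable_refl_diff d (X : measurableType d) (w a k : X -> E) :
  measurable_fun setT w -> measurable_fun setT a -> measurable_fun setT k ->
  measurable_fun setT (fun t => refl_diff (w t) (a t) (k t)).
Proof.
move=> mw ma mk; apply: measurable_diff => //.
  by apply: measurable_refl => //; exact: measurable_push.
exact: measurable_refl.
Qed.

Lemma g_refl_bisector w u : w != 0%R -> opposite w u ->
  g (refl (bisector w u) w) = g u.
Proof.
move=> w0 uw; have [u0 _] := uw.
by rewrite refl_bisector ?bisector_neq0// ghom ?enorm_gt0// g_radial.
Qed.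

(** Substitute k such that a + |a|k is the bisector of w and u + |u|h. The factor 4 combines the 2
    of [bisector_expanding] with |a| <= 2|u|; the radius becomes 2 delta because |u| <= |a|. *)
Lemma kern_le_refl_diff w u delta : w != 0%R -> opposite w u ->
  \int[lambda]_(h in ball delta `&` [set h | opposite w (u + enorm u *: h)%R])
    kern g u h <=
  (dilation n 4)%:E *
    \int[lambda]_(k in ball (2 * delta)) refl_diff w (bisector w u) k.
Proof.
move=> w0 uw; have [u0 _] := uw.
have au := enorm_bisector_ge w0 uw; have a2 := enorm_bisector_le w u.
have a0 := bisector_neq0 w0 uw; set a := bisector w u in au a2 a0 *.
have pu : (0 < enorm u)%R by rewrite enorm_gt0.
have pa : (0 < enorm a)%R by rewrite enorm_gt0.
pose v h := (u + enorm u *: h)%R.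
have vB h1 h2 : enorm (v h1 - v h2) = (enorm u * enorm (h1 - h2))%R.
  by rewrite /v opprD addrACA subrr add0r -scalerBr enormZ ger0_norm ?enorm_ge0.
have mv : measurable_fun setT v.
  by apply: measurable_push => //; exact: measurable_cst.
pose G h := ((enorm a)^-1 *: (bisector w (v h) - a))%R.
have mG : measurable_fun setT G.
  apply: measurable_cVZ; first exact: measurable_cst.
  apply: measurable_cVB; last exact: measurable_cst.
  by apply: measurable_bisector => //; exact: measurable_cst.
rewrite (_ : \int[lambda]_(h in _) _ = \int[lambda]_(h in ball delta `&`
    [set h | opposite w (v h)]) refl_diff w a (G h)); last first.
  apply: eq_integral => h; rewrite inE => -[_ vw].
  rewrite /refl_diff /G scalerA divff ?gt_eqF// scale1r [(a + _)%R]addrC subrK.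
  by rewrite !g_refl_bisector.
apply: lipschitz_integral_le => //.
- by apply: measurableI => //; exact: measurable_opposite.
- move=> h1 h2 [_ v1] [_ v2].
  have := bisector_expanding v1 v2; rewrite vB.
  have subBB (b1 b2 e : E) : (b1 - e - (b2 - e) = b1 - b2)%R.
    by rewrite opprB addrA subrK.
  rewrite /G -scalerBr subBB (enormZ (enorm a)^-1) gtr0_norm ?invr_gt0//.
  set D := enorm (h1 - h2); set B := enorm (_ - _) => H.
  rewrite mulrCA ler_pdivlMl// -(ler_pM2l pu).
  have D0 : (0 <= D)%R by exact: enorm_ge0.
  have B0 : (0 <= B)%R by exact: enorm_ge0.
  have : (enorm u * D * enorm a <= enorm u * D * (2 * enorm u))%R.
    by apply: ler_wpM2l => //; rewrite mulr_ge0// ltW.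
  have : (enorm u * D * enorm u <= 2 * B * enorm u)%R by rewrite ler_pM2r.
  lra.
- move=> h [/= hd vw]; rewrite /enball/= /G enormZ gtr0_norm ?invr_gt0//.
  rewrite ler_pdivrMl//.
  have := bisectorB_le w (v h) u; have := vB h 0%R.
  rewrite {2}/v scaler0 addr0 subr0 => -> H; apply: (le_trans H).
  have : (enorm u * enorm h <= enorm a * delta)%R.
    by apply: ler_pM => //; exact: enorm_ge0.
  lra.
by apply: measurable_refl_diff => //; exact: measurable_cst.
Qed.

(** The centre has norm 1/2 and direction opposite to u. By [enorm_sub_scale], moving it by 1/32
    turns its direction by at most 1/8, and passing from u to u + |u|h turns that of u by at most
    another 1/8, within the tolerance 1/4. *)
Lemma opposite_nbhd u h w : u != 0%R -> (enorm h <= 16^-1)%R ->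
  (enorm (w - (- 2^-1 *: radial u)) <= 32^-1)%R ->
  [/\ PB w, opposite w u & opposite w (u + enorm u *: h)%R].
Proof.
move=> u0 h16 wu; set c := (- 2^-1 *: radial u)%R in wu.
have nc : enorm c = (2^-1)%R.
  by rewrite /c (enormZ (- 2^-1)) enorm_radial// mulr1 normrN ger0_norm.
have w1 : (enorm w <= 1)%R.
  by have := enorm_sub_ge w c; rewrite nc; lra.
have w2 : (4^-1 <= enorm w)%R.
  have := enorm_sub_ge c w; rewrite enormBC nc; lra.
have rc : radial c = (- radial u)%R.
  by rewrite /c scaleNr -scalerN radialZ// radialN radialK.
have uw : (enorm (radial u + radial w) <= 8^-1)%R.
  have := enorm_sub_scale c w; rewrite nc rc enormBC.
  have -> : (radial w - - radial u)%R = (radial u + radial w)%R.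
    by rewrite opprK addrC.
  rewrite (enormBC c); lra.
have h1 : (enorm h < 1)%R by lra.
have v0 := shift_arg_neq0 h1 u0.
split.
- by rewrite /punctured_ball/= w1 andbT; lra.
- by split => //; lra.
split => //.
have pu : (0 < enorm u)%R by rewrite enorm_gt0.
have := enorm_sub_scale u (u + enorm u *: h).
rewrite opprD addNKr enormN (enormZ (enorm u)) ger0_norm ?enorm_ge0//.
rewrite mulrCA ler_pM2l// enormBC => H.
have -> : (radial (u + enorm u *: h) + radial w =
    (radial (u + enorm u *: h) - radial u) + (radial u + radial w))%R.
  by rewrite addrA subrK.
by rewrite (le_trans (enormD _ _))//; lra.
Qed.

(** The cut-off that inserts the auxiliary vector: for fixed small h and nonzero u the admissible w
    contain a ball of fixed radius, while for fixed nonzero w both points are, up to scaling,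
    reflections of w. *)
Definition localized u h w := if `[< opposite w u /\
  opposite w (u + enorm u *: h)%R >] then kern g u h else 0.

Lemma localized_ge0 u h w : 0 <= localized u h w.
Proof. by rewrite /localized; case: ifP. Qed.
#[local] Hint Resolve localized_ge0 : core.

Lemma localizedE u h w : opposite w u -> opposite w (u + enorm u *: h)%R ->
  localized u h w = kern g u h.
Proof. by move=> uw vw; rewrite /localized ifT//; exact/asboolP. Qed.

Lemma measurable_localized d (X : measurableType d) (u h w : X -> E) :
  measurable_fun setT u -> measurable_fun setT h -> measurable_fun setT w ->
  measurable_fun setT (fun t => localized (u t) (h t) (w t)).
Proof.
move=> mu mh mw.
pose V := [set t | opposite (w t) (u t)] `&`
  [set t | opposite (w t) (u t + enorm (u t) *: h t)%R].
apply: (eq_measurable_fun ((fun t => kern g (u t) (h t)) \_ V)).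
  by move=> t _; rewrite patchE.
apply/(measurable_restrictT _ _).1.
  apply: measurableI; apply: measurable_opposite => //.
  exact: measurable_push.
by apply: measurable_funTS; exact: measurable_kern.
Qed.

Lemma localized_lower u h : (0 < n)%N -> PB u -> (enorm h <= 16^-1)%R ->
  ((32^-1 / n%:R) ^+ n)%:E * kern g u h <=
    \int[lambda]_(w in PB) localized u h w.
Proof.
move=> n0 /andP[u0 _] h16; rewrite enorm_gt0 in u0.
pose W := [set w | enorm (w - (- 2^-1 *: radial u)) <= 32^-1]%R.
have mW : measurable W by exact: measurable_eball.
have ml : measurable_fun setT (fun w => localized u h w).
  by apply: measurable_localized => //; exact: measurable_cst.
have WPB : W `<=` PB by move=> w /(opposite_nbhd u0 h16)[].
apply: le_trans (ge0_subset_integral _ _ _ (measurable_funTS ml) _ WPB) => //.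
rewrite (_ : \int[_]_(w in W) _ = \int[lambda]_(w in W) cst (kern g u h) w).
  rewrite integral_cst// muleC; apply: lee_wpmul2l => //.
    exact: kern_ge0.
  exact: lebesgue_eball_ge.
apply: eq_integral => w; rewrite inE => /(opposite_nbhd u0 h16)[_ uw vw].
by rewrite localizedE.
Qed.

(** The integral in h is [kern_le_refl_diff]. The substitution a = [bisector w u] then expands
    distances up to the factor 2 and maps the punctured ball into the ball of radius 2. *)
Lemma localized_upper w delta : PB w ->
  \int[lambda]_(u in PB) \int[lambda]_(h in ball delta) localized u h w <=
  (dilation n 4 * dilation n 2)%:E *
    \int[lambda]_(a in ball 2)
      \int[lambda]_(k in ball (2 * delta)) refl_diff w a k.
Proof.
move=> /andP[w0 _]; rewrite enorm_gt0 in w0.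
pose O := [set u : E | opposite w u].
have mO : measurable O.
  by apply: measurable_opposite => //; exact: measurable_cst.
pose Phi a := \int[lambda]_(k in ball (2 * delta)) refl_diff w a k.
have Phi0 a : 0 <= Phi a by exact: integral_ge0.
have mPhi : measurable_fun setT Phi.
  apply: (@measurable_integral_in _ _ _ _ _ lambda (refl_diff w)) => //.
  by apply: measurable_refl_diff => //; exact: measurable_cst.
have mb : measurable_fun setT (bisector w).
  by apply: measurable_bisector => //; exact: measurable_cst.
apply: (@le_trans _ _ ((dilation n 4)%:E *
    \int[lambda]_(u in PB `&` O) Phi (bisector w u))); last first.
  rewrite EFinM -muleA; apply: lee_wpmul2l.
    by rewrite lee_fin dilation_ge0.
  apply: lipschitz_integral_le => //; first exact: measurableI.
  - by move=> x y [_ xO] [_ yO]; exact: bisector_expanding.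
  - move=> u [/andP[_ u1] _]; rewrite /enball/=.
    by rewrite (le_trans (enorm_bisector_le _ _))// ler_piMr.
have mPhib : measurable_fun setT (fun u => Phi (bisector w u)).
  exact: measurableT_comp mPhi mb.
rewrite integral_mkcondr -ge0_integralZl//; last 3 first.
- apply: measurable_funTS; apply/(measurable_restrictT _ _).1 => //.
  exact: measurable_funTS.
- by move=> u _; rewrite patchE; case: ifP.
- by rewrite lee_fin dilation_ge0.
apply: ge0_le_integralT => //.
- apply: (@measurable_integral_in _ _ _ _ _ lambda
    (fun u h => localized u h w)) => //.
  by apply: measurable_localized => //; exact: measurable_cst.
- apply: emeasurable_funM => //; apply/(measurable_restrictT _ _).1 => //.
  exact: measurable_funTS.
- by move=> u; exact: integral_ge0.
move=> u _; rewrite patchE; case: ifPn => [|uO]; last first.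
  rewrite mule0 integral0_eq// => h _; rewrite /localized ifF//.
  by apply/asboolP => -[uw _]; move: uO; rewrite mem_set.
rewrite inE => uO; apply: le_trans (kern_le_refl_diff delta w0 uO).
rewrite integral_mkcondr le_eqVlt; apply/orP; left; apply/eqP.
apply: eq_integral => h _; rewrite /localized patchE.
by congr (if _ then _ else _); apply: asbool_equiv_eq; split => [[]|].
Qed.

(** The triple integral of [localized] is bounded below by integrating in w first. Tonelli moves w
    outermost for the substitutions of [localized_upper], and then innermost again, where the
    hypothesis on [S] applies. *)
Lemma spread_le_refl delta S : (0 < n)%N -> (delta <= 16^-1)%R ->
  (forall a k, (enorm k <= 2 * delta)%R ->
    \int[lambda]_(w in PB) refl_diff w a k <= S) ->
  ((32^-1 / n%:R) ^+ n)%:E * spread g delta <=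
  (dilation n 4 * dilation n 2)%:E *
    (S * lambda (ball (2 * delta)) * lambda (ball 2)).
Proof.
move=> n0 d16 leS.
have c0 : 0 <= ((32^-1 / n%:R : R) ^+ n)%:E.
  by rewrite lee_fin exprn_ge0// divr_ge0.
have C0 : 0 <= (dilation n 4 * dilation n 2 : R)%:E.
  by rewrite lee_fin mulr_ge0 ?dilation_ge0.
have mL : measurable_fun setT
    (fun p : (E * E) * E => localized p.1.1 p.1.2 p.2).
  apply: measurable_localized => //.
    exact: measurableT_comp measurable_fst measurable_fst.
  exact: measurableT_comp measurable_snd measurable_fst.
have mH : measurable_fun setT
    (fun p : (E * E) * E => refl_diff p.2 p.1.1 p.1.2).
  apply: measurable_refl_diff => //.
    exact: measurableT_comp measurable_fst measurable_fst.
  exact: measurableT_comp measurable_snd measurable_fst.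
have LH u h w : 0 <= localized u h w by exact: localized_ge0.
have RH a k w : 0 <= refl_diff w a k by exact: refl_diff_ge0.
apply: (@le_trans _ _ (\int[lambda]_(u in PB) \int[lambda]_(h in ball delta)
    \int[lambda]_(w in PB) localized u h w)).
  rewrite -ge0_integralZl//; last 2 first.
  - by apply: measurable_funTS; exact: measurable_spread_in.
  - by move=> u _; exact: integral_ge0.
  apply: ge0_le_integral => //.
  - by move=> u _; rewrite mule_ge0//; exact: integral_ge0.
  - apply: measurable_funTS; apply: emeasurable_funM => //.
    exact: measurable_spread_in.
  - by apply: measurable_funTS; exact: (measurable_integral_yz _ _ mL).
  move=> u uPB; rewrite -ge0_integralZl//; last first.
    by apply: measurable_funTS; exact: measurable_kern.
  apply: ge0_le_integralT => //.
  - by apply: emeasurable_funM => //; exact: measurable_kern.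
  - apply: (@measurable_integral_in _ _ _ _ _ lambda (localized u)) => //.
    by apply: measurable_localized => //; exact: measurable_cst.
  - by move=> h; rewrite mule_ge0.
  by move=> h hd; apply: localized_lower => //; exact: le_trans hd d16.
rewrite (tonelli3 _ _ _ mL LH)//.
apply: (@le_trans _ _ ((dilation n 4 * dilation n 2)%:E * \int[lambda]_(w in PB)
    \int[lambda]_(a in ball 2)
      \int[lambda]_(k in ball (2 * delta)) refl_diff w a k)).
  have mRH :=
    measurable_integral_xy lambda lambda mH RH (mball 2) (mball (2 * delta)).
  rewrite -ge0_integralZl//; last 2 first.
  - exact: measurable_funTS.
  - by move=> w _; apply: integral_ge0 => a _; exact: integral_ge0.
  apply: ge0_le_integral => //.
  - by move=> w _; apply: integral_ge0 => u _; exact: integral_ge0.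
  - by apply: measurable_funTS; exact: measurable_integral_xy.
  - by apply: measurable_funTS; exact: emeasurable_funM.
  - by move=> w wPB; exact: localized_upper.
apply: lee_wpmul2l => //.
rewrite -(tonelli3 _ _ _ mH RH)// -(integral_cst lambda (mball 2)).
apply: ge0_le_integralT => //.
- exact: (measurable_integral_yz _ _ mH).
- by move=> a; apply: integral_ge0 => k _; exact: integral_ge0.
move=> a _; rewrite -(integral_cst lambda (mball (2 * delta))).
apply: ge0_le_integralT => //.
- apply: (@measurable_integral_in _ _ _ _ _ lambda
    (fun k w => refl_diff w a k)) => //.
  by apply: measurable_refl_diff => //; exact: measurable_cst.
- by move=> k; exact: integral_ge0.
by move=> k kd; exact: leS.
Qed.

End rotation_averages.

(** * Comparison of the moduli of continuity *)

Section moduli.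
Local Open Scope ereal_scope.
Context {R : realType} {n : nat} (g : 'cV[R]_n -> R).
Notation E := 'cV[R]_n.
Notation lambda := (lebesgue_cV R n).
Notation PB := (@punctured_ball R n).
Notation ball := (enball R n).
Hypotheses (n0 : (0 < n)%N) (mg : measurable_fun setT g)
  (ghom : forall (a : R) (x : E), (0 < a)%R -> g (a *: x)%R = g x).
Implicit Types (a h k u v w x y : E) (T : E -> E) (delta : R).

Let mPB : measurable PB := @measurable_punctured_ball R n.
Let mball delta : measurable (ball delta) := measurable_enball delta.
#[local] Hint Resolve mPB mball : core.

Lemma rotation_normP (rho : 'M[R]_n) delta : rotation rho ->
  (rotation_norm rho <= delta)%R <->
  (forall x, enorm (rho *m x - x) <= delta * enorm x)%R.
Proof.
move=> rrho; rewrite /rotation_norm; set A := [set _ | x in _].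
(* The sphere is nonempty because n > 0; [sup] is a true least upper bound only for nonempty bounded
   sets. *)
have A0 : A !=set0.
  pose x : E := radial (const_mx 1%R).
  exists (enorm (rho *m x - x)), x => //; rewrite /sphere/= enorm_radial//.
  apply/eqP => /colP/(_ (Ordinal n0)); rewrite !mxE => /eqP.
  by rewrite oner_eq0.
have ubA : has_ubound A.
  exists 2%R => _ [x sx <-]; rewrite (le_trans (enormB _ _))//.
  by rewrite enorm_rotation// sx.
split => [Ad x|H]; last first.
  apply: ge_sup => // _ [x sx <-]; rewrite (le_trans (H x))//.
  by rewrite sx mulr1.
have [->|x0] := eqVneq x 0%R; first by rewrite mulmx0 subrr enorm0 mulr0.
rewrite -{1 2}(enorm_radialK x) -scalemxAr -scalerBr (enormZ (enorm x)).
rewrite ger0_norm ?enorm_ge0// mulrC ler_wpM2r ?enorm_ge0//.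
apply: le_trans Ad; apply: ub_le_sup => //; exists (radial x) => //.
by rewrite /sphere/= enorm_radial.
Qed.

Definition modulus_rot delta := ereal_sup
  [set displacement g (mulmx rho) | rho in
    [set rho : 'M[R]_n | rotation rho /\ (rotation_norm rho <= delta)%R]].

Definition modulus_trans delta := ereal_sup
  [set displacement g (fun x => x + enorm x *: h)%R | h in
    [set h : E | (enorm h <= delta)%R]].

Lemma displacement_shift h :
  displacement g (shift h) = displacement g (fun x => x + enorm x *: h)%R.
Proof.
apply: eq_integral => x; rewrite inE => /andP[x0 _].
by rewrite /shift ghom// g_radial.
Qed.

Lemma measurable_shift h : measurable_fun setT (shift h).
Proof.
apply: measurable_cVZ; first exact: measurable_enorm.
apply: measurable_radial_comp; apply: measurable_push => //.
Qed.

Lemma displacement_bounded T (c : R) : measurable_fun setT T -> (0 < c)%R ->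
  (forall x, enorm (T x) = enorm x) ->
  (forall x y, enorm (x - y) <= c * enorm (T x - T y))%R ->
  displacement g T <=
    (dilation n c + 1)%:E * \int[lambda]_(x in PB) `|g x|%:E.
Proof.
move=> mT c0 nT eT.
have mabs : measurable_fun setT (fun x => `|g x|%:E).
  by apply/measurable_EFinP; exact: measurableT_comp.
have mabsT : measurable_fun setT (fun x => `|g (T x)|%:E).
  exact: measurableT_comp mabs mT.
apply: (@le_trans _ _ (\int[lambda]_(x in PB) (`|g (T x)|%:E + `|g x|%:E))).
  apply: ge0_le_integralT => //.
  - exact: measurable_diff.
  - exact: emeasurable_funD.
  - by move=> x _; rewrite -EFinD lee_fin ler_normB.
have I0 : 0 <= \int[lambda]_(x in PB) `|g x|%:E.
  by apply: integral_ge0 => x _; rewrite lee_fin.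
rewrite ge0_integralD//; try exact: measurable_funTS.
rewrite EFinD ge0_muleDl ?lee_fin ?dilation_ge0 ?(ltW c0)// mul1e leeD2r//.
apply: (@lipschitz_integral_le _ _ PB T c mPB mT c0 _ PB
  (fun x => `|g x|%:E)) => //.
by move=> x; rewrite /punctured_ball/= nT.
Qed.

(** Compares a cube containing the large ball with a cube inside the small one. *)
Lemma ball_doubling (s delta : R) : (0 < s)%R -> (0 < delta)%R ->
  lambda (ball (s * delta)) <= ((4 * s * n%:R) ^+ n)%:E * lambda (ball delta).
Proof.
move=> s0 d0; apply: (le_trans (lebesgue_enball_le _)); first exact: mulr_gt0.
have -> : ((4 * (s * delta)) ^+ n =
    (4 * s * n%:R) ^+ n * (delta / n%:R) ^+ n)%R.
  rewrite -exprMn; congr (_ ^+ _)%R; field.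
  by rewrite pnatr_eq0 -lt0n.
rewrite EFinM lee_wpmul2l ?lebesgue_enball_ge ?(ltW d0)// lee_fin.
by rewrite exprn_ge0// !mulr_ge0// ltW.
Qed.

Lemma modulus_rot_ge0 delta : (0 <= delta)%R -> 0 <= modulus_rot delta.
Proof.
move=> d0; apply: (@le_trans _ _ (displacement g (mulmx 1%:M))).
  by apply: integral_ge0 => x _; rewrite lee_fin.
have r1 : rotation (1%:M : 'M[R]_n).
  by split; rewrite ?trmx1 ?mulmx1// det1.
apply: ereal_sup_ubound; exists 1%:M => //; split => //.
apply/rotation_normP => // x; rewrite mul1mx subrr enorm0.
by rewrite mulr_ge0// enorm_ge0.
Qed.

Lemma modulus_trans_ge0 delta : (0 <= delta)%R -> 0 <= modulus_trans delta.
Proof.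
move=> d0.
apply: (@le_trans _ _ (displacement g (fun x => x + enorm x *: 0)%R)).
  by apply: integral_ge0 => x _; rewrite lee_fin.
by apply: ereal_sup_ubound; exists 0%R => //=; rewrite enorm0.
Qed.

(** Substituting z = [refl b w] turns the two reflections of w into z and its image under the
    rotation [rho]. The directions of a and b differ by at most 2|k| <= 4 delta, and [refl_near]
    contributes another factor 4, whence 16. *)
Lemma refl_diff_le a k delta : (delta <= 16^-1)%R -> (enorm k <= 2 * delta)%R ->
  \int[lambda]_(w in PB) refl_diff g w a k <=
  (dilation n 1)%:E * modulus_rot (16 * delta).
Proof.
move=> d16 kd.
have d0 : (0 <= delta)%R by have := enorm_ge0 k; lra.
have [->|a0] := eqVneq a 0%R.
  rewrite integral0_eq; last first.
    by move=> w _; rewrite /refl_diff enorm0 scale0r addr0 subrr normr0.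
  by rewrite mule_ge0 ?lee_fin ?dilation_ge0 ?modulus_rot_ge0// mulr_ge0.
set b := (a + enorm a *: k)%R.
have b0 : b != 0%R by apply: shift_arg_neq0 => //; lra.
pose rho := refl_mx a *m refl_mx b.
have rrho : rotation rho by exact: rotation_refl.
have rhoE z : rho *m z = refl a (refl b z) by rewrite -mulmxA !refl_mxE.
have pa : (0 < enorm a)%R by rewrite enorm_gt0.
have ab : (enorm (radial a - radial b) <= 4 * delta)%R.
  have := enorm_sub_scale a b.
  rewrite /b opprD addNKr enormN (enormZ (enorm a)) ger0_norm ?enorm_ge0//.
  by rewrite mulrCA ler_pM2l//; lra.
have norm_rho : (rotation_norm rho <= 16 * delta)%R.
  apply/rotation_normP => // z; rewrite rhoE (le_trans (refl_near _ _ _))//.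
  by rewrite ler_wpM2r ?enorm_ge0//; lra.
apply: (@le_trans _ _ ((dilation n 1)%:E * displacement g (mulmx rho)));
    last first.
  apply: lee_wpmul2l; first by rewrite lee_fin dilation_ge0.
  by apply: ereal_sup_ubound; exists rho.
have -> : \int[lambda]_(w in PB) refl_diff g w a k =
    \int[lambda]_(w in PB) (fun z => `|g (rho *m z) - g z|%:E) (refl b w).
  by apply: eq_integral => w _; rewrite rhoE reflK /refl_diff -/b distrC.
apply: lipschitz_integral_le => //.
- by apply: measurable_refl => //; exact: measurable_cst.
- by move=> x y _ _; rewrite mul1r -reflB enorm_refl.
- by move=> w; rewrite /punctured_ball/= enorm_refl.
- by apply: measurable_diff => //; exact: measurable_mulmx.
Qed.

Let le_mul_fin (x y m : \bar R) : 0 < m -> m \is a fin_num ->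
  x * m <= y * m -> x <= y.
Proof. by move=> m0 mf; rewrite lee_pmul2r. Qed.

Let ball_fin delta : (0 < delta)%R ->
  0 < lambda (ball delta) /\ lambda (ball delta) \is a fin_num.
Proof.
move=> d0; have l0 : 0 < lambda (ball delta).
  apply: lt_le_trans (lebesgue_enball_ge n0 (ltW d0)).
  by rewrite lte_fin exprn_gt0// divr_gt0// ltr0n.
split => //; rewrite ge0_fin_numE ?(ltW l0)//.
by apply: le_lt_trans (lebesgue_enball_le d0) _; rewrite ltry.
Qed.

(** A rotation is an isometry moving points by at most delta|x|, so [displacement_le_spread] applies
    with c = 1 and eta = delta. Then [spread_le] bounds the spread at 2 delta, and [ball_doubling]
    cancels the volumes. *)
Lemma modulus_rot_le : exists C : R, (0 <= C)%R /\
  forall delta, (0 < delta)%R ->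
    modulus_rot delta <= C%:E * modulus_trans (2 * delta).
Proof.
pose K : R := (1 + dilation n 1 * dilation n 1)%R.
have K0 : (0 <= K)%R by rewrite addr_ge0// mulr_ge0// dilation_ge0.
pose L : R := ((4 * 2 * n%:R) ^+ n)%R.
have L0 : (0 <= L)%R by rewrite exprn_ge0.
exists (K * L)%R; split; first exact: mulr_ge0.
move=> delta d0; apply: ge_ereal_sup => _ [rho [rrho rd] <-].
have [l0 lf] := ball_fin d0; apply: (le_mul_fin l0 lf).
have mrho := measurable_mulmx rho (@measurable_id _ E setT).
have := displacement_le_spread mg delta mrho ltr01 (ltW d0).
move=> /(_ (fun x => enorm_rotation x rrho)).
have e1 x y : (enorm (x - y) <= 1 * enorm (rho *m x - rho *m y))%R.
  by rewrite mul1r -mulmxBr enorm_rotation.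
move=> /(_ e1 ((rotation_normP _ rrho).1 rd)) /le_trans; apply.
rewrite -EFinD -/K EFinM -!muleA; apply: lee_wpmul2l => //.
rewrite (_ : (delta + delta = 2 * delta)%R); last by ring.
apply: (@le_trans _ _ (modulus_trans (2 * delta) * lambda (ball (2 * delta)))).
  apply: spread_le => // h hd; apply: ereal_sup_ubound.
  by exists h.
rewrite muleCA; apply: lee_wpmul2l; last exact: ball_doubling.
by rewrite modulus_trans_ge0// mulr_ge0// ltW.
Qed.

(** Here [shift h] plays the role of [T], with c = 9 and eta = 2 delta, which leads to the spread at
    3 delta. The passage to rotations multiplies this by 16, whence 48, and brings in the ball of
    radius 6 delta. *)
Lemma modulus_trans_le : exists C : R, (0 <= C)%R /\
  forall delta, (0 < delta)%R -> (delta <= 48^-1)%R ->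
    modulus_trans delta <= C%:E * modulus_rot (48 * delta).
Proof.
pose K : R := (1 + dilation n 1 * dilation n 9)%R.
have K0 : (0 <= K)%R by rewrite addr_ge0// mulr_ge0// dilation_ge0.
pose c0 : R := ((32^-1 / n%:R) ^+ n)%R.
have c00 : (0 < c0)%R by rewrite exprn_gt0// divr_gt0// ltr0n.
pose A : R := (dilation n 4 * dilation n 2 * dilation n 1)%R.
have A0 : (0 <= A)%R by rewrite !mulr_ge0// dilation_ge0.
pose L : R := ((4 * 6 * n%:R) ^+ n)%R.
have L0 : (0 <= L)%R by rewrite exprn_ge0.
pose B : R := fine (lambda (ball 2)).
have B0 : (0 <= B)%R by rewrite fine_ge0.
have BE : lambda (ball 2) = B%:E.
  by rewrite fineK//; have [] := ball_fin (ltr0n R 2).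
exists (K / c0 * A * L * B)%R; split.
  exact: mulr_ge0 (mulr_ge0 (mulr_ge0 (divr_ge0 K0 (ltW c00)) A0) L0) B0.
move=> delta d0 d48; apply: ge_ereal_sup => _ [h hd <-].
have h1 : (enorm h < 1)%R by move: hd => /=; lra.
have [l0 lf] := ball_fin d0; apply: (le_mul_fin l0 lf).
rewrite -displacement_shift.
have dd0 : (0 <= 2 * delta)%R by lra.
have := displacement_le_spread mg delta (measurable_shift h) (ltr0n R 9) dd0.
move=> /(_ (fun x => enorm_shift x h1) (fun x y => shift_expanding x y h1)).
have near x : (enorm (shift h x - x) <= 2 * delta * enorm x)%R.
  rewrite (le_trans (shift_near x h1))// ler_wpM2r ?enorm_ge0//.
  by rewrite ler_pM2l.
move=> /(_ near) /le_trans; apply.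
rewrite -EFinD -/K (_ : (delta + 2 * delta = 3 * delta)%R); last by ring.
have d16 : (3 * delta <= 16^-1)%R by lra.
set m := modulus_rot _.
have m0 : 0 <= m by rewrite modulus_rot_ge0// mulr_ge0// ltW.
have := spread_le_refl mg ghom n0 d16 (fun a k => @refl_diff_le a k _ d16).
rewrite !mulrA (_ : 16 * 3 = 48)%R; last by ring.
rewrite (_ : 2 * 3 = 6)%R; last by ring.
rewrite -/m -/c0 BE => H.
have {}H : c0%:E * spread g (3 * delta) <=
    c0%:E * ((A / c0 * L * B)%:E * m * lambda (ball delta)).
  apply: (le_trans H).
  have -> : c0%:E * ((A / c0 * L * B)%:E * m * lambda (ball delta)) =
      (A * B)%:E * m * (L%:E * lambda (ball delta)).
    rewrite !muleA (muleAC (A * B)%:E m) -!EFinM.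
    do 2 congr (_ * _); congr EFin.
    by field; rewrite gt_eqF.
  have -> : (dilation n 4 * dilation n 2)%:E *
      ((dilation n 1)%:E * m * lambda (ball (6 * delta)) * B%:E) =
      (A * B)%:E * m * lambda (ball (6 * delta)).
    by rewrite !muleA (muleAC _ _ B%:E) (muleAC _ m B%:E) -!EFinM.
  by apply: lee_wpmul2l; rewrite ?ball_doubling// mule_ge0// lee_fin mulr_ge0.
have {}H : spread g (3 * delta) <=
    (A / c0 * L * B)%:E * m * lambda (ball delta).
  by move: H; rewrite lee_pmul2l.
apply: (@le_trans _ _ (K%:E * ((A / c0 * L * B)%:E * m * lambda (ball delta)))).
  exact: lee_wpmul2l.
rewrite !muleA -EFinM le_eqVlt; apply/orP; left; apply/eqP.
by do 2 congr (_ * _); congr EFin; rewrite /A; field; rewrite gt_eqF.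
Qed.

(** These bounds control the Dini integrals away from 0. For translations, delta < 1 ensures that
    [shift h] preserves the norm. *)
Lemma modulus_bounded : \int[lambda]_(x in PB) `|g x|%:E < +oo ->
  exists M : R, (forall delta, modulus_rot delta <= M%:E) /\
    (forall delta, (delta < 1)%R -> modulus_trans delta <= M%:E).
Proof.
move=> gfin; set I := \int[_]_(_ in _) _ in gfin.
have I0 : 0 <= I by apply: integral_ge0 => x _; rewrite lee_fin.
have If : I \is a fin_num by rewrite ge0_fin_numE.
have IE : I = (fine I)%:E by rewrite fineK.
exists (Num.max ((dilation n 1 + 1) * fine I) ((dilation n 9 + 1) * fine I))%R.
split => [delta|delta d1]; apply: ge_ereal_sup.
  move=> _ [rho [rrho _] <-]; rewrite EFin_max le_max EFinM -IE.
  rewrite displacement_bounded//.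
  - exact: measurable_mulmx.
  - by move=> x; exact: enorm_rotation.
  - by move=> x y; rewrite mul1r -mulmxBr enorm_rotation.
move=> _ [h hd <-]; rewrite EFin_max le_max !EFinM -IE -displacement_shift.
have h1 : (enorm h < 1)%R by exact: le_lt_trans hd d1.
rewrite [X in _ || X]displacement_bounded ?orbT//.
- exact: measurable_shift.
- by move=> x; exact: enorm_shift.
- by move=> x y; exact: shift_expanding.
Qed.

End moduli.

(** * Dini integrals *)

Lemma nondecreasing_emeasurable (R : realType) (f : R -> \bar R) :
  {homo f : x y / x <= y >-> (x <= y)%E} -> measurable_fun setT f.
Proof.
move=> ndf; apply: (measurability _ (ErealGenCInfty.measurableE R)) => //.
move=> _ [_ [r ->] <-]; rewrite setTI.
apply: is_interval_measurable => x y /= fx _ z /andP[xz _].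
by move: fx; rewrite !in_itv/= !andbT => /le_trans; apply; exact: ndf.
Qed.

(** * Dilations of the real line *)

Section lebesgue_measure_scale.
Local Open Scope ereal_scope.
Context {R : realType} (k : R).
Hypothesis k0 : (0 < k)%R.
Notation mu := (@lebesgue_measure R).

Let scale (x : measurableTypeR R) : measurableTypeR R := (k * x)%R.

Let mscale_fun : measurable_fun setT scale.
Proof. exact: measurable_funM. Qed.

Let nu : {measure set (measurableTypeR R) -> \bar R} :=
  mscale (NngNum (ltW k0))
    (measure_function_pushforward__canonical__measure_function_Measure
       mu mscale_fun).

(** By uniqueness of Lebesgue measure, half-open intervals suffice. *)
Lemma lebesgue_measure_scale A : measurable A ->
  mu A = k%:E * mu (scale @^-1` A).
Proof.
move=> mA; rewrite (lebesgue_measure_unique (mu := nu))// => _ [[a b] _ <-] /=.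
rewrite -[RHS]/(k%:E * mu (scale @^-1` `]a, b]%classic)).
rewrite (_ : scale @^-1` _ = `]a / k, b / k]%classic)%R; last first.
  apply/seteqP; split => x /=; rewrite !in_itv/= /scale ltr_pdivrMr//;
  by rewrite ler_pdivlMr// (mulrC k).
rewrite !lebesgue_measure_itv/= !lte_fin ltr_pM2r ?invr_gt0//.
case: ifPn => ab; last by rewrite mule0.
by rewrite -!EFinB -EFinM -mulrBl mulrCA divff ?mulr1// gt_eqF.
Qed.

Lemma ge0_integral_scale (f : R -> \bar R) (D : set (measurableTypeR R)) :
  measurable D -> measurable_fun D f -> (forall x, D x -> 0 <= f x) ->
  \int[mu]_(x in D) f x = k%:E * \int[mu]_(x in scale @^-1` D) f (k * x)%R.
Proof.
move=> mD mf f0.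
rewrite (eq_measure_integral (nu : {measure set _ -> \bar R})); last first.
  by move=> A mA _; exact: lebesgue_measure_scale.
rewrite ge0_integral_mscale//; congr (_ * _).
by rewrite ge0_integral_pushforward// => x; rewrite inE => /f0.
Qed.

End lebesgue_measure_scale.

(** Split the integral at 1/K. Below it, compare with [om2 (K * x)] and substitute y = K x, under
    which dx/x is invariant. Above it, the integrand is at most M K. *)
Lemma dini_le (R : realType) (om1 om2 : R -> \bar R) (C K M : R) :
  0 <= C -> 1 < K ->
  {homo om1 : x y / x <= y >-> (x <= y)%E} ->
  {homo om2 : x y / x <= y >-> (x <= y)%E} ->
  (forall x : R, 0 <= x -> (0 <= om1 x)%E) ->
  (forall x : R, 0 <= x -> (0 <= om2 x)%E) ->
  (forall x : R, 0 < x -> x <= K^-1 -> (om1 x <= C%:E * om2 (K * x)%R)%E) ->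
  (forall x : R, x < 1 -> (om1 x <= M%:E)%E) ->
  dini om2 -> dini om1.
Proof.
move=> C0 K1 nd1 nd2 om10 om20 om12 omM; rewrite /dini.
have K0 : 0 < K by rewrite (lt_trans _ K1).
have Ki : 0 < K^-1 by rewrite invr_gt0.
pose F (om : R -> \bar R) x := (om x * (x^-1)%:E)%E.
have mF om (D : set R) : measurable D -> D `<=` [set x | 0 < x] ->
    {homo om : x y / x <= y >-> (x <= y)%E} -> measurable_fun D (F om).
  move=> mD D0 ndom; apply: emeasurable_funM.
    by apply: measurable_funTS; exact: nondecreasing_emeasurable.
  apply/measurable_EFinP; apply: (eq_measurable_fun (fun x => powR x (-1))).
    by move=> x; rewrite inE => /D0 x0; rewrite powR_inv1// ltW.
  by apply: measurable_funTS; exact: measurable_powR.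
have F0 om x : (forall x : R, 0 <= x -> (0 <= om x)%E) -> 0 < x ->
    (0 <= F om x)%E.
  by move=> om0 x0; rewrite mule_ge0 ?om0 ?lee_fin ?invr_ge0 ?ltW.
have sub1 : `]0, 1[ `<=` [set x : R | 0 < x].
  by move=> x /=; rewrite in_itv/= => /andP[].
have E1 : `]0, 1[%classic = `]0, K^-1[%classic `|` `[K^-1, 1[%classic :> set R.
  by apply: itv_bndbnd_setU; rewrite bnd_simp// invf_le1// ltW.
have sub2 : `]0, K^-1[ `<=` [set x : R | 0 < x].
  by move=> x /=; rewrite in_itv/= => /andP[].
have sub3 : `[K^-1, 1[ `<=` [set x : R | 0 < x].
  by move=> x /=; rewrite in_itv/= => /andP[/(lt_le_trans Ki)].
move=> dom2; rewrite E1 ge0_integral_setU//; last 3 first.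
- by rewrite -E1; exact: mF.
- by rewrite -E1 => x /sub1; exact: F0.
- rewrite /disj_set; apply/eqP/seteqP; split => // x [] /=.
  by rewrite !in_itv/= => /andP[_ /lt_le_trans xK] /andP[/xK]; rewrite ltxx.
have M0 : 0 <= M.
  by rewrite -lee_fin; apply: le_trans (om10 0 (lexx _)) (omM 0 ltr01).
apply: lte_add_pinfty.
  have : (C%:E * \int[lebesgue_measure]_(x in `]0%R, 1%R[) F om2 x < +oo)%E.
    by rewrite lte_mul_pinfty// lee_fin.
  apply: le_lt_trans.
  have E2 : (fun x : R => K * x) @^-1` `]0, 1[%classic = `]0, K^-1[%classic.
    apply/seteqP; split => x /=; rewrite !in_itv/= pmulr_rgt0//;
    by rewrite -[K^-1]mulr1 ltr_pdivlMl.
  have mFK : measurable_fun `]0, K^-1[ (fun x => F om2 (K * x)).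
    have m01 : measurable (`]0, 1[%classic : set R) by exact: measurable_itv.
    have KS : (fun x : R => K * x) @` `]0, K^-1[%classic `<=` `]0, 1[%classic.
      by move=> _ [x + <-]; rewrite -E2.
    have mK : measurable_fun (`]0, K^-1[%classic : set R) (fun x : R => K * x).
      exact: measurable_funM.
    exact: measurable_comp m01 KS (mF _ _ m01 sub1 nd2) mK.
  rewrite (ge0_integral_scale K0)//; last 2 first.
  - exact: mF.
  - by move=> x /sub1; exact: F0.
  rewrite E2 muleA -EFinM -ge0_integralZl//; last 2 first.
  - by move=> x /sub2 x0; apply: F0 => //; exact: mulr_gt0.
  - by rewrite lee_fin mulr_ge0// ltW.
  apply: ge0_le_integral => //.
  - by move=> x /sub2; exact: F0.
  - exact: mF.
  - by apply: emeasurable_funM.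
  move=> x xD; have x0 : 0 < x by exact: sub2.
  have xK : x <= K^-1 by move: xD; rewrite /= in_itv/= => /andP[_ /ltW].
  apply: (@le_trans _ _ (C%:E * om2 (K * x)%R * (x^-1)%:E)%E).
    by apply: lee_wpmul2r; rewrite ?om12// lee_fin invr_ge0 ltW.
  rewrite /F EFinM -!muleA lee_wpmul2l// muleCA -EFinM.
  by rewrite invfM mulrA divff ?mul1r// gt_eqF.
apply: (@le_lt_trans _ _
  (\int[lebesgue_measure]_(x in `[K^-1%R, 1%R[) cst (M * K)%:E x)%E).
  apply: ge0_le_integral => //.
  - by move=> x /sub3; exact: F0.
  - exact: mF.
  move=> x; rewrite /= in_itv/= => /andP[Kx x1]; rewrite EFinM.
  have x0 : 0 < x by exact: lt_le_trans Kx.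
  apply: lee_pmul; [exact/om10/ltW|by rewrite lee_fin invr_ge0 ltW|exact: omM|].
  by rewrite lee_fin -[leRHS]invrK lef_pV2// posrE.
rewrite integral_cst//; apply: lte_mul_pinfty => //.
  by rewrite lee_fin mulr_ge0// ltW.
have := lebesgue_measure_itv `[K^-1, 1[; rewrite /= => ->.
by case: ifP => _; rewrite ?ltry// -EFinB ltry.
Qed.

(** * Completion of finite measures *)

Section completion.
Local Open Scope ereal_scope.
Context d (T : measurableType d) (R : realType).
Variable (mu : {measure set T -> \bar R}).
Hypothesis mu_fin : mu setT < +oo.
Notation cara := (caratheodory_type (mu_ext mu)).
Notation mubar := (completed_measure_extension (mu := mu)).

Lemma mu_extE A : measurable A -> mu_ext mu A = mu A.
Proof. exact: measurable_mu_extE. Qed.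

Lemma mu_ext_fin A : mu_ext mu A < +oo.
Proof.
by apply: le_lt_trans mu_fin; rewrite -mu_extE//; exact: le_outer_measure.
Qed.

(** Intersect countable measurable covers of E with excess at most 1/(k+1). *)
Lemma mu_ext_hull E :
  exists F, [/\ measurable F, E `<=` F & mu F = mu_ext mu E].
Proof.
have fE : mu_ext mu E \is a fin_num.
  by rewrite ge0_fin_numE ?mu_ext_fin ?mu_ext_ge0.
have /choice[A AP] k : exists A, [/\ measurable A, E `<=` A &
    mu A <= mu_ext mu E + k.+1%:R^-1%:E].
  have k0 : (0 < k.+1%:R^-1 :> R)%R by rewrite invr_gt0.
  have [_ [B [mB EB] <-] /ltW BE] := lb_ereal_inf_adherent k0 fE.
  exists (\bigcup_i B i); split => //; first exact: bigcupT_measurable.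
  apply: le_trans BE; apply: measure_sigma_subadditive => //.
  exact: bigcupT_measurable.
have mF : measurable (\bigcap_k A k).
  by apply: bigcapT_measurable => k; have [] := AP k.
exists (\bigcap_k A k); split => //.
  by move=> x Ex k _; have [_ + _] := AP k; exact.
apply/eqP; rewrite eq_le; apply/andP; split; last first.
  rewrite -mu_extE//; apply: le_mu_ext => x Ex k _.
  by have [_ + _] := AP k; exact.
apply/lee_addgt0Pr => _/posnumP[e].
have [k _ /(_ k (leqnn k)) ke] := near_infty_natSinv_lt e.
have [mA _ Ak] := AP k.
apply: (@le_trans _ _ (mu (A k))).
  by apply: le_measure; rewrite ?inE//; exact: bigcap_inf.
by rewrite (le_trans Ak)// leeD2l// lee_fin ltW.
Qed.

(** Take [F] a measurable hull of [E] and [N] one of the difference. The extension is additive on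
    Caratheodory sets and finite, so the difference has outer measure 0. *)
Lemma caratheodory_ae (E : set cara) : measurable E ->
  exists F N : set T, [/\ measurable F, measurable N, mu N = 0, E `<=` F &
    F `\` E `<=` N].
Proof.
move=> mE; have [F [mF EF muF]] := mu_ext_hull E.
have [N [mN FN muN]] := mu_ext_hull (F `\` E).
exists F, N; split => //; rewrite muN.
have mF' : (measurable : set (set cara)) F.
  exact: caratheodory_measurable_mu_ext.
have : mubar (F `\` E) = mubar F - mubar (F `&` E).
  by apply: measureD => //; exact: mu_ext_fin.
rewrite setIidr// /completed_measure_extension/= => ->.
rewrite mu_extE// muF subee// ge0_fin_numE ?mu_ext_fin//.
exact: mu_ext_ge0.
Qed.

(** The sublevel sets at rational heights determine [f]. Each is Borel up to a null set, and the
    union of these countably many null sets is covered by a single one. *)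
Lemma measurable_fun_completion (D : set T) (f : T -> R) : measurable D ->
  measurable_fun (D : set cara) f ->
  exists N : set T, [/\ measurable N, mu N = 0 & measurable_fun (D `\` N) f].
Proof.
move=> mD mf.
have mD' : (measurable : set (set cara)) D.
  exact: caratheodory_measurable_mu_ext.
have /choice[F FP] (q : rat) : exists F : set T, measurable F /\
    exists N : set T, [/\ measurable N, mu N = 0,
      D `&` [set x | f x < ratr q]%R `<=` F &
      F `\` (D `&` [set x | f x < ratr q]%R) `<=` N].
  have mq : (measurable : set (set cara)) (D `&` [set x | f x < ratr q]%R).
    rewrite (_ : mkset _ = f @^-1` `]-oo, ratr q[%classic).
      exact: mf.
    by apply/seteqP; split => x /=; rewrite in_itv.
  have [F [N [mF mN N0 EF FN]]] := caratheodory_ae mq.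
  by exists F; split => //; exists N.
have /choice[N NP] (q : rat) := (FP q).2.
have [M [mM M0 NM]] : mu.-negligible
    (\bigcup_k (if unpickle k is Some q then N q else set0)).
  apply: negligible_bigcup => k.
  case: unpickle => [q|]; last exact: negligible_set0.
  by have [mN N0 _ _] := NP q; apply/negligibleP.
exists M; split => // mDM.
apply: (measurability _ (RGenInftyO.measurableE R)) => //.
move=> _ [_ [r ->] <-].
(* The set where f < r is the union of those where f < q over rational q <= r, and off [M] each of
   these agrees with [F q] on [D]. *)
have -> : (D `\` M) `&` f @^-1` `]-oo, r[ =
    (D `\` M) `&` \bigcup_(q in [set q : rat | ratr q <= r]%R) F q.
  apply/seteqP; split => x [[Dx Mx]] /=.
    rewrite in_itv/= => fr; split => //.
    have [q] := rat_in_itvoo fr; rewrite in_itv/= => /andP[fq qr].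
    by exists q; [exact: ltW|have [_ _ + _] := NP q; apply].
  move=> [q qr Fx]; split => //; rewrite in_itv/=.
  apply: contrapT => /negP; rewrite -leNgt => rf; apply: Mx; apply: NM.
  exists (pickle q); [exact: I|rewrite pickleK].
  have [_ _ _] := NP q; apply; split => // -[_] /=.
  by apply/negP; rewrite -leNgt (le_trans qr).
apply: measurableI => //; rewrite bigcup_mkcond.
apply: bigcupT_measurable_rat => q.
by case: ifP => // _; exact: (FP q).1.
Qed.

(** Completeness of the extension makes [F] measurable, as it equals [G] off a null set. The
    identity then pushes the extension forward to [mu]. *)
Lemma integral_completion (D N : set T) (F G : T -> \bar R) :
  measurable D -> measurable N -> mu N = 0 -> measurable_fun D G ->
  (forall x, 0 <= F x) -> (forall x, 0 <= G x) ->
  (forall x, D x -> ~ N x -> F x = G x) ->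
  \int[mubar]_(x in D) F x = \int[mu]_(x in D) G x.
Proof.
move=> mD mN N0 mG F0 G0 FG.
have mB (A : set T) : measurable A -> (measurable : set (set cara)) A.
  exact: caratheodory_measurable_mu_ext.
have mid : measurable_fun setT (id : cara -> T).
  by move=> _ A mA; rewrite setTI; exact: mB.
have mG' : measurable_fun (D : set cara) G.
  by move=> mD' A mA; apply: mB; exact: mG.
have ae : ae_eq mubar D G F.
  exists N; split => //; first exact: mB.
    by apply: etrans N0; exact: mu_extE.
  by move=> x /=; apply: contra_notP => Nx Dx; rewrite FG.
have mF' : measurable_fun (D : set cara) F.
  apply: ae_measurable_fun ae mG'.
  exact: measure_is_complete_caratheodory.
transitivity (\int[mubar]_(x in D) G x).
  by apply/esym; apply: ge0_ae_eq_integral ae => //; exact: mB.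
transitivity (\int[pushforward mubar (id : cara -> T)]_(x in D) G x).
  by rewrite ge0_integral_pushforward.
apply: eq_measure_integral => A mA _.
exact: mu_extE.
Qed.

End completion.

(** * The surface measure *)

Section surface.
Local Open Scope ereal_scope.
Context {R : realType} {n : nat}.
Notation E := 'cV[R]_n.
Notation lambda := (lebesgue_cV R n).
Notation PB := (@punctured_ball R n).
Notation S := (sphere R n).
Notation surf := (surface_measure R n).

Let mPB : measurable PB := @measurable_punctured_ball R n.
Let mS : measurable S := @measurable_sphere R n.
#[local] Hint Resolve mPB mS : core.

Lemma surface_measure_fin : surf setT < +oo.
Proof.
rewrite /surface_measure preimage_setT setTI lte_mul_pinfty// ?lee_fin//.
apply: le_lt_trans (ltry ((4 * 1) ^+ n : R)%R).
apply: le_trans (lebesgue_enball_le ltr01).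
apply: le_measure; rewrite ?inE//; first exact: measurable_enball.
by move=> x /andP[].
Qed.

(** Polar coordinates are built into [surface_measure], a pushforward under [radial], which sends
    the punctured ball into the sphere. *)
Lemma integral_surface (F : E -> \bar R) :
  measurable_fun setT F -> (forall x, 0 <= F x) ->
  \int[surf]_(x in S) F x = n%:R%:E * \int[lambda]_(x in PB) F (radial x).
Proof.
move=> mF F0; have mr := @measurable_radial R n.
have mFr : measurable_fun setT (F \o radial) by exact: measurableT_comp mr.
have mrS : measurable (radial @^-1` S).
  by rewrite -[X in measurable X]setTI; exact: mr.
rewrite (eq_measure_integral (pushforward
  (mscale (n%:R%:nng : {nonneg R})%R (mrestr lambda mPB)) radial))//.
rewrite ge0_integral_pushforward//; last exact: measurable_funTS.
rewrite ge0_integral_mscale//; last 2 first.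
- exact: measurable_funTS.
- by move=> x _; exact: F0.
congr (_ * _); rewrite integral_mkcond ge0_integral_mrestr//; last 2 first.
- apply/(measurable_restrictT _ _).1 => //; exact: measurable_funTS.
- by move=> x; rewrite patchE; case: ifP => // _; exact: F0.
apply: eq_integral => x; rewrite inE => /andP[x0 _].
by rewrite patchE mem_set//= /sphere/= enorm_radial// -enorm_gt0.
Qed.

(** Needed to change Omega on a null set inside [Omega (T x)]. As [T] commutes with [radial], the
    cone over the preimage lies in the preimage of the cone over [N], which is null because [T] is
    expanding. *)
Lemma surface_measure_null (T : E -> E) (c : R) (N : set E) : (0 < n)%N ->
  measurable_fun setT T -> (0 < c)%R -> (forall x, enorm (T x) = enorm x) ->
  (forall (a : R) x, (0 < a)%R -> T (a *: x) = a *: T x)%R ->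
  (forall x y, enorm (x - y) <= c * enorm (T x - T y))%R ->
  measurable N -> surf N = 0 -> surf (S `&` T @^-1` N) = 0.
Proof.
move=> n0 mT c0 nT hT eT mN.
have nn : (n%:R : R)%:E != 0 by rewrite eqe pnatr_eq0 -lt0n.
rewrite /surface_measure => /eqP; rewrite mule_eq0 (negbTE nn)/= => /eqP N0.
set A := _ `&` PB; suff -> : lambda A = 0 by rewrite mule0.
have mr := @measurable_radial R n.
have mpre (B : set E) (f : E -> E) : measurable_fun setT f -> measurable B ->
    measurable (f @^-1` B).
  by move=> mf mB; rewrite -[X in measurable X]setTI; exact: mf.
have mV : measurable (radial @^-1` N `&` PB).
  by apply: measurableI => //; exact: mpre.
have mA : measurable A.
  apply: measurableI => //; apply: (mpre) => //.
  by apply: measurableI => //; exact: mpre.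
have := lipschitz_measure_le mPB mT c0 (fun x y _ _ => eT x y) mV.
rewrite N0 mule0 => le0.
apply/eqP; rewrite eq_le measure_ge0 andbT; apply: le_trans le0.
apply: le_measure; rewrite ?inE//.
  by apply: measurableI => //; exact: mpre.
move=> x [[_ /= Nx] Px]; split => //=; have /andP[x0 _] := Px.
split; last by rewrite /punctured_ball/= nT.
suff -> : radial (T x) = T (radial x) by [].
by rewrite {2}/radial hT ?invr_gt0// /radial nT.
Qed.

End surface.

(** * A Borel homogeneous representative of Omega *)

Section representative.
Local Open Scope ereal_scope.
Context {R : realType} {n : nat} (n0 : (0 < n)%N) (Omega : 'cV[R]_n -> R).
Notation E := 'cV[R]_n.
Notation lambda := (lebesgue_cV R n).
Notation PB := (@punctured_ball R n).
Notation S := (sphere R n).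
Notation surf := (surface_measure R n).
Hypothesis Omega_hom : forall (a : R) (x : E),
  (0 < a)%R -> x != 0%R -> Omega (a *: x)%R = Omega x.

Let mS : measurable S := @measurable_sphere R n.
#[local] Hint Resolve mS : core.

Lemma Omega_radial x : x != 0%R -> Omega (radial x) = Omega x.
Proof. by move=> x0; rewrite Omega_hom// invr_gt0 enorm_gt0. Qed.

(** Set Omega to 0 on a null set off which it is Borel on the sphere, and extend it along rays
    through [radial]. *)
Lemma borel_representative : L1_sphere Omega ->
  exists (g : E -> R) (N : set E), [/\ measurable_fun setT g,
    forall (a : R) x, (0 < a)%R -> g (a *: x)%R = g x,
    measurable N /\ surf N = 0,
    forall x, x != 0%R -> ~ N (radial x) -> Omega x = g x &
    \int[lambda]_(x in PB) `|g x|%:E < +oo].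
Proof.
move=> /integrableP[/measurable_EFinP mO intO].
have [N [mN N0 mON]] := measurable_fun_completion surface_measure_fin mS mO.
pose g0 := Omega \_ (S `\` N).
have mg0 : measurable_fun setT g0.
  by apply/(measurable_restrictT _ _).1 => //; exact: measurableD.
have Og x : x != 0%R -> ~ N (radial x) -> Omega x = g0 (radial x).
  move=> x0 Nx; rewrite /g0 patchE mem_set ?Omega_radial//; split => //.
  by rewrite /sphere/= enorm_radial.
have mg : measurable_fun setT (g0 \o radial).
  by apply: measurableT_comp mg0 _; exact: measurable_radial.
exists (g0 \o radial), N; split => //.
  by move=> a x a0; rewrite /= radialZ.
have mabs : measurable_fun setT (fun x => `|(g0 \o radial) x|%:E).
  by apply/measurable_EFinP; exact: measurableT_comp.
have : \int[sigma R n]_(x in S) `|Omega x|%:E =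
    n%:R%:E * \int[lambda]_(x in PB) `|(g0 \o radial) x|%:E.
  transitivity (\int[surf]_(x in S) `|(g0 \o radial) x|%:E).
    apply: (integral_completion mS mN N0) => //.
      exact: measurable_funTS.
    move=> x Sx Nx; rewrite Og//; first exact: sphere_neq0.
    by rewrite radial_sphere.
  rewrite integral_surface//.
  congr (_ * _); apply: eq_integral => x _.
  by rewrite /= radialK.
move: intO => /[swap] -> H.
have I0 : 0 <= \int[lambda]_(x in PB) `|(g0 \o radial) x|%:E.
  by apply: integral_ge0 => x _; rewrite lee_fin.
apply: le_lt_trans H; rewrite -[leLHS]mul1e; apply: lee_wpmul2r => //.
by rewrite lee_fin ler1n.
Qed.

(** [U] is the map in the definition of a modulus; [T] is a norm-preserving map with the same
    directions on the sphere. Omega and [g] can differ at x or at U x only when x lies in [N] or T x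
    does, and both sets are null. *)
Lemma integral_sigma_diff (g : E -> R) (N : set E) (T U : E -> E) (c : R) :
  measurable_fun setT g ->
  (forall (a : R) x, (0 < a)%R -> g (a *: x)%R = g x) ->
  measurable N -> surf N = 0 ->
  (forall x, x != 0%R -> ~ N (radial x) -> Omega x = g x) ->
  measurable_fun setT T -> (0 < c)%R -> (forall x, enorm (T x) = enorm x) ->
  (forall (a : R) x, (0 < a)%R -> T (a *: x) = a *: T x)%R ->
  (forall x y, enorm (x - y) <= c * enorm (T x - T y))%R ->
  (forall x, S x -> U x != 0%R /\ radial (U x) = T x) ->
  \int[sigma R n]_(x in S) `|Omega (U x) - Omega x|%:E =
  n%:R%:E * displacement g T.
Proof.
move=> mg hg mN N0 Og mT c0 nT hT eT UT.
have gr := g_radial hg.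
have mG : measurable_fun setT (fun x => `|g (T x) - g x|%:E).
  exact: measurable_diff.
have mSN : measurable (S `&` T @^-1` N).
  by apply: measurableI => //; rewrite -[X in measurable X]setTI; exact: mT.
have N0' : surf (N `|` (S `&` T @^-1` N)) = 0.
  apply/eqP; rewrite eq_le measure_ge0 andbT.
  apply: (@le_trans _ _ (surf N + surf (S `&` T @^-1` N))).
    exact: measureU2.
  by rewrite N0 (surface_measure_null n0 mT c0 nT hT eT mN N0) adde0.
transitivity (\int[surf]_(x in S) `|g (T x) - g x|%:E).
  apply: (integral_completion mS (measurableU _ _ mN mSN) N0') => //.
    exact: measurable_funTS.
  move=> x Sx /not_orP[Nx /not_andP[//|TNx]].
  have [U0 rU] := UT x Sx.
  rewrite (Og x) ?radial_sphere//; last exact: sphere_neq0.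
  by rewrite (Og (U x)) ?rU// -gr rU.
rewrite integral_surface//; congr (_ * _); apply: eq_integral => x.
rewrite inE => /andP[x0 _].
by rewrite {1}/radial hT ?invr_gt0// !gr hg// invr_gt0.
Qed.

End representative.

(** * Transfer of the comparison from the representative to Omega *)

Section omega_moduli.
Local Open Scope ereal_scope.
Context {R : realType} {n : nat} (n0 : (0 < n)%N) (Omega : 'cV[R]_n -> R).
Notation E := 'cV[R]_n.
Hypotheses (Omega_hom : forall (a : R) (x : E),
    (0 < a)%R -> x != 0%R -> Omega (a *: x)%R = Omega x)
  (Omega_L1 : L1_sphere Omega).

Lemma le_omega_rot : {homo omega_rot Omega : x y / (x <= y)%R >-> x <= y}.
Proof.
move=> x y xy; apply: le_ereal_sup => _ [rho [rrho rx] <-]; exists rho => //.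
by split => //; exact: le_trans rx xy.
Qed.

Lemma le_omega_trans : {homo omega_trans Omega : x y / (x <= y)%R >-> x <= y}.
Proof.
move=> x y xy; apply: le_ereal_sup => _ [h hx <-]; exists h => //.
exact: le_trans hx xy.
Qed.

Lemma omega_rot_ge0 delta : (0 <= delta)%R -> 0 <= omega_rot Omega delta.
Proof.
move=> d0; apply: ereal_sup_ge; eexists; first exists (1%:M : 'M[R]_n) => //.
  split; first by split; rewrite ?trmx1 ?mulmx1// det1.
  apply/rotation_normP => // [|x].
    by split; rewrite ?trmx1 ?mulmx1// det1.
  by rewrite mul1mx subrr enorm0 mulr_ge0// enorm_ge0.
by apply: integral_ge0 => x _; rewrite lee_fin.
Qed.

Lemma omega_trans_ge0 delta : (0 <= delta)%R -> 0 <= omega_trans Omega delta.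
Proof.
move=> d0; apply: ereal_sup_ge; eexists; first exists (0%R : E) => //.
  by rewrite /= enorm0.
by apply: integral_ge0 => x _; rewrite lee_fin.
Qed.

(** The moduli of Omega are n times those of [g], for translations only when delta < 1, where x + h
    does not meet 0. *)
Lemma omega_moduli_comparison : exists C M : R, [/\ (0 <= C)%R,
  forall delta : R, (0 < delta)%R -> (delta <= 3^-1)%R ->
    omega_rot Omega delta <= C%:E * omega_trans Omega (3 * delta),
  forall delta : R, (0 < delta)%R -> (delta <= 48^-1)%R ->
    omega_trans Omega delta <= C%:E * omega_rot Omega (48 * delta),
  forall delta : R, omega_rot Omega delta <= M%:E &
  forall delta : R, (delta < 1)%R -> omega_trans Omega delta <= M%:E].
Proof.
have [g [N [mg hg [mN N0] Og gfin]]] :=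
  borel_representative n0 Omega_hom Omega_L1.
have rotE (rho : 'M[R]_n) : rotation rho ->
    \int[sigma R n]_(x in sphere R n) `|Omega (rho *m x) - Omega x|%:E =
    n%:R%:E * displacement g (mulmx rho).
  move=> rrho; have nrho x := enorm_rotation x rrho.
  apply: (@integral_sigma_diff _ _ n0 _ g N (mulmx rho) (mulmx rho) 1%R) => //.
  - exact: measurable_mulmx.
  - by move=> a x _; rewrite -scalemxAr.
  - by move=> x y; rewrite mul1r -mulmxBr nrho.
  - move=> x Sx; split; first by rewrite -enorm_gt0 nrho Sx.
    by rewrite radial_sphere// /sphere/= nrho.
have transE h : (enorm h < 1)%R ->
    \int[sigma R n]_(x in sphere R n) `|Omega (x + h)%R - Omega x|%:E =
    n%:R%:E * displacement g (fun x => x + enorm x *: h)%R.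
  move=> h1; rewrite -displacement_shift//.
  apply: (@integral_sigma_diff _ _ n0 _ g N (shift h)
    (fun x => x + h)%R 9%R) => //.
  - exact: measurable_shift.
  - by move=> x; exact: enorm_shift.
  - move=> a x a0; rewrite /shift enormZ gtr0_norm//.
    have -> : (a *: x + (a * enorm x) *: h = a *: (x + enorm x *: h))%R.
      by rewrite scalerDr scalerA.
    by rewrite (radialZ _ a0) scalerA.
  - by move=> x y; exact: shift_expanding.
  - move=> x Sx; rewrite /shift Sx !scale1r; split => //.
    by have := shift_arg_neq0 h1 (sphere_neq0 Sx); rewrite Sx scale1r.
have n1 : 1 <= (n%:R : R)%:E by rewrite lee_fin ler1n.
have disp0 T : 0 <= displacement g T.
  by apply: integral_ge0 => x _; rewrite lee_fin.
have rot_le delta : omega_rot Omega delta <= n%:R%:E * modulus_rot g delta.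
  apply: ge_ereal_sup => _ [rho [rrho rd] <-]; rewrite rotE//.
  apply: lee_wpmul2l; first by rewrite lee_fin.
  by apply: ereal_sup_ubound; exists rho.
have rot_ge delta : modulus_rot g delta <= omega_rot Omega delta.
  apply: ge_ereal_sup => _ [rho [rrho rd] <-].
  apply: (@le_trans _ _ (n%:R%:E * displacement g (mulmx rho))).
    by rewrite -[leLHS]mul1e; apply: lee_wpmul2r.
  by rewrite -rotE//; apply: ereal_sup_ubound; exists rho.
have trans_le delta : (delta < 1)%R ->
    omega_trans Omega delta <= n%:R%:E * modulus_trans g delta.
  move=> d1; apply: ge_ereal_sup => _ [h hd <-].
  rewrite transE; last exact: le_lt_trans hd d1.
  by apply: lee_wpmul2l; rewrite ?lee_fin//; apply: ereal_sup_ubound; exists h.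
have trans_ge delta : (delta < 1)%R ->
    modulus_trans g delta <= omega_trans Omega delta.
  move=> d1; apply: ge_ereal_sup => _ [h hd <-].
  apply: (@le_trans _ _
    (n%:R%:E * displacement g (fun x => x + enorm x *: h)%R)).
    by rewrite -[leLHS]mul1e; apply: lee_wpmul2r.
  rewrite -transE; last exact: le_lt_trans hd d1.
  by apply: ereal_sup_ubound; exists h.
have [C1 [C10 le1]] := modulus_rot_le n0 mg.
have [C2 [C20 le2]] := modulus_trans_le n0 mg hg.
have [M [rotM transM]] := modulus_bounded mg hg gfin.
have nM x : x <= M%:E -> n%:R%:E * x <= (n%:R * M)%:E.
  by move=> xM; rewrite EFinM; apply: lee_wpmul2l => //; rewrite lee_fin.
exists (n%:R * (C1 + C2))%R, (n%:R * M)%R; split.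
- by rewrite mulr_ge0// addr_ge0.
- move=> delta d0 d3; apply: (le_trans (rot_le _)).
  rewrite EFinM -muleA; apply: lee_wpmul2l; first by rewrite lee_fin.
  apply: (le_trans (le1 _ d0)).
  apply: (@le_trans _ _ (C1%:E * omega_trans Omega (3 * delta))).
    apply: lee_wpmul2l; first by rewrite lee_fin.
    (* With the factor 3 in place of 2, the condition delta <= 1/3 keeps 2 delta strictly below 1,
       even at the endpoint. *)
    by apply: (le_trans (trans_ge _ _)); [lra|apply: le_omega_trans; lra].
  apply: lee_wpmul2r; last by rewrite lee_fin lerDl.
  by apply: omega_trans_ge0; lra.
- move=> delta d0 d48; apply: (le_trans (trans_le _ _)); first by lra.
  rewrite EFinM -muleA; apply: lee_wpmul2l; first by rewrite lee_fin.
  apply: (le_trans (le2 _ d0 d48)).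
  apply: (@le_trans _ _ (C2%:E * omega_rot Omega (48 * delta))).
    by apply: lee_wpmul2l; rewrite ?lee_fin.
  apply: lee_wpmul2r; last by rewrite lee_fin lerDr.
  by apply: omega_rot_ge0; lra.
- by move=> delta; apply: le_trans (rot_le _) (nM _ _).
- by move=> delta d1; apply: le_trans (trans_le _ d1) (nM _ _); exact: transM.
Qed.

End omega_moduli.

Theorem theorem2p5 (R : realType) (n : nat) (n_gt0 : (0 < n)%N)
    (Omega : 'cV[R]_n -> R)
    (Omega_measurable :
       measurable_fun [set x : lebesgue_type R n | x != 0 :> 'cV[R]_n] Omega)
    (Omega_homogeneous : forall (lambda : R) (x : 'cV[R]_n),
       0 < lambda -> x != 0 -> Omega (lambda *: x) = Omega x) :
  L1_dini_rotations Omega <-> L1_dini_translations Omega.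
Proof.
rewrite /L1_dini_rotations /L1_dini_translations.
split=> -[L1 din]; split=> //;
  have [C [M [C0 rt tr rM tM]]] :=
    omega_moduli_comparison n_gt0 Omega_homogeneous L1.
- apply: (dini_le C0 (_ : 1 < 48) (@le_omega_trans _ _ _) (@le_omega_rot _ _ _)
    (@omega_trans_ge0 _ _ _) (@omega_rot_ge0 _ _ n_gt0 _) tr tM din).
  by rewrite ltr1n.
- apply: (dini_le C0 (_ : 1 < 3) (@le_omega_rot _ _ _) (@le_omega_trans _ _ _)
    (@omega_rot_ge0 _ _ n_gt0 _) (@omega_trans_ge0 _ _ _) rt
    (fun x _ => rM x) din).
  by rewrite ltr1n.
Qed.
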